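(* Let $\Lambda=KQ/\langle I\rangle$ be a gentle algebra. Then the Cohen-Macaulay Auslander algebra $\mathrm{Aus}(\mathrm{Gproj}\,\Lambda)$ of $\Lambda$ is isomorphic to $KQ^{Aus}/\langle I^{Aus}\rangle$, where $(Q^{Aus},I^{Aus})$ is the bound quiver constructed from $(Q,I)$ in the context.
   Context: Conventions: $K$ is an algebraically closed field; algebras are basic finite-dimensional associative $K$-algebras; modules are finitely generated left modules. For a finite quiver $Q=(Q_0,Q_1)$, an arrow $\alpha$ starts at $s(\alpha)$ and ends at $t(\alpha)$; paths are composed from right to left, i.e. $\alpha_1\alpha_2\cdots\alpha_r$ is a path if $t(\alpha_i)=s(\alpha_{i-1})$ for $i=2,\dots,r$. Gentle algebra: $\Lambda=KQ/\langle I\rangle$ is a gentle algebra if $\langle I\rangle$ is an admissible ideal of $KQ$ generated by a set $I$ of zero relations of length $2$ (paths of length $2$), and: each vertex is the starting point of at most two arrows and the ending point of at most two arrows; for each arrow $\alpha$ there is at most one arrow $\beta$ with $t(\beta)=s(\alpha)$ and $\alpha\beta\notin I$, and at most one arrow $\gamma$ with $s(\gamma)=t(\alpha)$ and $\gamma\alpha\notin I$; for each arrow $\alpha$ there is at most one arrow $\beta$ with $t(\beta)=s(\alpha)$ and $\alpha\beta\in I$, and at most one arrow $\gamma$ with $s(\gamma)=t(\alpha)$ and $\gamma\alpha\in I$. Gorenstein projective modules: a $\Lambda$-module $G$ is Gorenstein projective if there is an exact complex $\cdots\to P^{-1}\to P^0\xrightarrow{d^0}P^1\to\cdots$ of projective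 $\Lambda$-modules which stays exact under $\mathrm{Hom}_\Lambda(-,\Lambda)$ and with $G\cong\ker d^0$. $\mathrm{Gproj}\,\Lambda$ is the full subcategory of finitely generated Gorenstein projective modules. $\Lambda$ is CM-finite if $\mathrm{Gproj}\,\Lambda$ has only finitely many isomorphism classes of indecomposable objects (gentle algebras are CM-finite). In that case, if $E_1,\dots,E_n$ are all the pairwise non-isomorphic indecomposable Gorenstein projective modules, the Cohen-Macaulay Auslander algebra of $\Lambda$ is $\mathrm{Aus}(\mathrm{Gproj}\,\Lambda)=\mathrm{End}_\Lambda(\bigoplus_{i=1}^n E_i)^{op}$. $\mathcal{C}(\Lambda)$ denotes the set of equivalence classes, up to cyclic permutation, of repetition-free cyclic paths $\alpha_1\cdots\alpha_n$ in $Q$ such that $\alpha_i\alpha_{i+1}\in I$ for all $i$ (with $n+1:=1$). Construction of $(Q^{Aus},I^{Aus})$: let $Q_1^{cyc}$ be the set of arrows of $Q$ lying on some cycle $c\in\mathcal{C}(\Lambda)$, and $Q_1^{ncyc}=Q_1\setminus Q_1^{cyc}$. The vertex set is $Q_0^{Aus}=Q_0\sqcup Q_1^{cyc}$. The arrow set is $Q_1^{Aus}=Q_1^{ncyc}\sqcup\{\alpha^+:s(\alpha)\to\alpha\mid\alpha\in Q_1^{cyc}\}\sqcup\{\alpha^-:\alpha\to t(\alpha)\mid\alpha\in Q_1^{cyc}\}$, where arrows in $Q_1^{ncyc}$ keep their endpoints in $Q_0$. The relations are $I^{Aus}=\{\beta^+\alpha^-\mid\beta\alpha\in I,\ \alpha,\beta\in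 Q_1^{cyc}\}\cup\{\beta\alpha\mid\beta\alpha\in I,\ \alpha,\beta\in Q_1^{ncyc}\}$. *)

(* Defs.v *)
From HB Require Import structures.
From mathcomp Require Import all_boot all_algebra.
From mathcomp Require Import boolp.
From mathcomp Require Import finmap.
From mathcomp Require Import monalg.

Set Implicit Arguments.
Unset Strict Implicit.
Unset Printing Implicit Defensive.

Import GRing.Theory.
Local Open Scope ring_scope.
Local Open Scope quotient_scope.

(* The library's [algType] excludes the zero ring, whereas the quotients and
   endomorphism rings below may be zero.  A K-algebra is therefore given here
   as a possibly zero ring together with a central ring morphism from K; the
   K-linear structure is [k . x = kalg_in k * x]. *)
HB.mixin Record isKAlgebra (K : fieldType) A of GRing.PzRing A := {
  kalg_in : {rmorphism K -> A};
  kalg_inC : forall k x, kalg_in k * x = x * kalg_in k }.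

#[short(type="kalgType")]
HB.structure Definition KAlgebra (K : fieldType) :=
  {A of GRing.PzRing A & isKAlgebra K A}.

(* A ring morphism is K-linear iff it commutes with the structure maps. *)
Definition kalg_iso (K : fieldType) (A B : kalgType K) : Prop :=
  exists f : {rmorphism A -> B},
    (forall k : K, f (kalg_in k) = kalg_in k) /\ bijective f.

Section ConverseAlgebra.
Variables (K : fieldType) (A : kalgType K).

Definition conv_in (k : K) : A^c := kalg_in k : A.

Let conv_in_zmod : zmod_morphism conv_in.
Proof. exact: (@raddfB K A kalg_in). Qed.
Let conv_in_monoid : monoid_morphism conv_in.
Proof.
split; first exact: (@rmorph1 K A kalg_in).
by move=> k l; rewrite [LHS](@rmorphM K A kalg_in) kalg_inC.
Qed.

HB.instance Definition _ := GRing.isZmodMorphism.Build K A^c conv_in conv_in_zmod.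
HB.instance Definition _ :=
  GRing.isMonoidMorphism.Build K A^c conv_in conv_in_monoid.

Let conv_inC k (x : A^c) : conv_in k * x = x * conv_in k.
Proof. exact: esym (kalg_inC k (x : A)). Qed.

HB.instance Definition _ := isKAlgebra.Build K A^c conv_inC.
End ConverseAlgebra.

Record ideal (K : fieldType) (A : kalgType K) := Ideal {
  ideal_mem :> A -> Prop;
  ideal0 : ideal_mem 0;
  idealD : forall x y, ideal_mem x -> ideal_mem y -> ideal_mem (x + y);
  idealMl : forall a x, ideal_mem x -> ideal_mem (a * x);
  idealMr : forall x a, ideal_mem x -> ideal_mem (x * a) }.

Section GeneratedIdeal.
Variables (K : fieldType) (A : kalgType K) (S : A -> Prop).

Definition gen_mem (x : A) : Prop :=
  forall J : ideal A, (forall s, S s -> J s) -> J x.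

Let gen0 : gen_mem 0. Proof. by move=> J _; exact: ideal0. Qed.
Let genD x y : gen_mem x -> gen_mem y -> gen_mem (x + y).
Proof. by move=> hx hy J SJ; apply: idealD; [exact: hx|exact: hy]. Qed.
Let genMl a x : gen_mem x -> gen_mem (a * x).
Proof. by move=> hx J SJ; apply: idealMl; exact: hx. Qed.
Let genMr x a : gen_mem x -> gen_mem (x * a).
Proof. by move=> hx J SJ; apply: idealMr; exact: hx. Qed.

Definition gen_ideal : ideal A := Ideal gen0 genD genMl genMr.
End GeneratedIdeal.

Section QuotientAlgebra.
Variables (K : fieldType) (A : kalgType K) (J : ideal A).

Lemma idealN x : J x -> J (- x).
Proof. by move=> Jx; rewrite -mulN1r; exact: idealMl. Qed.

Lemma idealB x y : J x -> J y -> J (x - y).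
Proof. by move=> Jx Jy; apply: idealD => //; exact: idealN. Qed.

Definition ideal_pred : {pred A} := fun x => `[< J x >].

Lemma ideal_pred_zmod : zmod_closed ideal_pred.
Proof.
split=> [|x y /asboolP Jx /asboolP Jy]; apply/asboolP; first exact: ideal0.
exact: idealB.
Qed.

HB.instance Definition _ :=
  GRing.isZmodClosed.Build A ideal_pred ideal_pred_zmod.

Definition quot_alg : Type := Quotient.quot ideal_pred.

HB.instance Definition _ := GRing.Zmodule.on quot_alg.

Definition qpi (x : A) : quot_alg := \pi_(Quotient.quot ideal_pred) x.
Definition qrepr (u : quot_alg) : A := repr (u : Quotient.quot ideal_pred).

Lemma qreprK : cancel qrepr qpi. Proof. exact: reprK. Qed.

Lemma qpiP x y : qpi x = qpi y <-> J (x - y).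
Proof.
split=> [/eqquotP|Jxy]; last apply/eqquotP.
  by rewrite /Quotient.equiv => /asboolP.
by rewrite /Quotient.equiv; apply/asboolP.
Qed.

Lemma qpi_zmod : zmod_morphism qpi.
Proof. by move=> x y; rewrite /qpi raddfB. Qed.

HB.instance Definition _ := GRing.isZmodMorphism.Build A quot_alg qpi qpi_zmod.

Definition qone : quot_alg := qpi 1.
Definition qmul (u v : quot_alg) : quot_alg := qpi (qrepr u * qrepr v).

Lemma qpi_repr x : J (qrepr (qpi x) - x).
Proof. by apply/qpiP; rewrite qreprK. Qed.

Lemma qpi_qmul x y : qpi (x * y) = qmul (qpi x) (qpi y).
Proof.
apply/esym/qpiP.
rewrite -[_ * _](addrNK (x * qrepr (qpi y))) -mulrBl -addrA -mulrBr.
by apply: idealD; [apply: idealMr|apply: idealMl]; exact: qpi_repr.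
Qed.

Let qmulA : associative qmul.
Proof.
move=> u v w; rewrite -[u]qreprK -[v]qreprK -[w]qreprK.
by rewrite -!qpi_qmul mulrA.
Qed.
Let qmul1 : left_id qone qmul.
Proof. by move=> u; rewrite -[u]qreprK -qpi_qmul mul1r. Qed.
Let qmulr1 : right_id qone qmul.
Proof. by move=> u; rewrite -[u]qreprK -qpi_qmul mulr1. Qed.
Let qmulDl : left_distributive qmul +%R.
Proof.
move=> u v w; rewrite -[u]qreprK -[v]qreprK -[w]qreprK.
by rewrite -raddfD -!qpi_qmul -raddfD mulrDl.
Qed.
Let qmulDr : right_distributive qmul +%R.
Proof.
move=> u v w; rewrite -[u]qreprK -[v]qreprK -[w]qreprK.
by rewrite -raddfD -!qpi_qmul -raddfD mulrDr.
Qed.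

HB.instance Definition _ := GRing.Zmodule_isPzRing.Build quot_alg
  qmulA qmul1 qmulr1 qmulDl qmulDr.

Lemma qpi_monoid : monoid_morphism qpi.
Proof. by split=> // x y; exact: qpi_qmul. Qed.

HB.instance Definition _ :=
  GRing.isMonoidMorphism.Build A quot_alg qpi qpi_monoid.

Let qinC k (u : quot_alg) : (qpi \o kalg_in) k * u = u * (qpi \o kalg_in) k.
Proof. by rewrite -[u]qreprK /= -!rmorphM kalg_inC. Qed.

HB.instance Definition _ := isKAlgebra.Build K quot_alg qinC.
End QuotientAlgebra.

Section Modules.
Variable R : pzRingType.
Implicit Types M N : lmodType R.

Definition mod_iso M N : Prop := exists f : {linear M -> N}, bijective f.

Definition mod_zero M : Prop := forall x : M, x = 0.

Definition fin_generated M : Prop :=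
  exists (n : nat) (g : 'I_n -> M),
    forall x : M, exists c : 'I_n -> R, x = \sum_(i < n) c i *: g i.

Definition projective M : Prop :=
  forall (X Y : lmodType R) (p : {linear X -> Y}) (f : {linear M -> Y}),
    (forall y, exists x, p x = y) ->
    exists g : {linear M -> X}, forall m, p (g m) = f m.

Definition indecomposable M : Prop :=
  ~ mod_zero M /\
  forall M1 M2 : lmodType R,
    mod_iso M (M1 * M2)%type -> mod_zero M1 \/ mod_zero M2.

End Modules.

Section DirectSum.
Variables (R : pzRingType) (n : nat) (E : 'I_n -> lmodType R).

Definition dsum : Type := forall i, E i.

HB.instance Definition _ := gen_eqMixin dsum.
HB.instance Definition _ := gen_choiceMixin dsum.

Definition dsum_zero : dsum := fun=> 0.
Definition dsum_add (x y : dsum) : dsum := fun i => x i + y i.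
Definition dsum_opp (x : dsum) : dsum := fun i => - x i.
Definition dsum_scale (a : R) (x : dsum) : dsum := fun i => a *: x i.

Let dsum_addA : associative dsum_add.
Proof. by move=> x y z; apply: functional_extensionality_dep => i; exact: addrA. Qed.
Let dsum_addC : commutative dsum_add.
Proof. by move=> x y; apply: functional_extensionality_dep => i; exact: addrC. Qed.
Let dsum_add0 : left_id dsum_zero dsum_add.
Proof. by move=> x; apply: functional_extensionality_dep => i; exact: add0r. Qed.
Let dsum_addN : left_inverse dsum_zero dsum_opp dsum_add.
Proof. by move=> x; apply: functional_extensionality_dep => i; exact: addNr. Qed.

HB.instance Definition _ :=
  GRing.isZmodule.Build dsum dsum_addA dsum_addC dsum_add0 dsum_addN.

Let dsum_scaleA a b x : dsum_scale a (dsum_scale b x) = dsum_scale (a * b) x.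
Proof. by apply: functional_extensionality_dep => i; exact: scalerA. Qed.
Let dsum_scale1 : left_id 1 dsum_scale.
Proof. by move=> x; apply: functional_extensionality_dep => i; exact: scale1r. Qed.
Let dsum_scaleDr : right_distributive dsum_scale +%R.
Proof. by move=> a x y; apply: functional_extensionality_dep => i; exact: scalerDr. Qed.
Let dsum_scaleDl x : {morph dsum_scale^~ x : a b / a + b}.
Proof. by move=> a b; apply: functional_extensionality_dep => i; exact: scalerDl. Qed.

HB.instance Definition _ := GRing.Zmodule_isLmodule.Build R dsum
  dsum_scaleA dsum_scale1 dsum_scaleDr dsum_scaleDl.
End DirectSum.

Lemma linear_eqP (R : pzRingType) (M N : lmodType R) (f g : {linear M -> N}) :
  f =1 g -> f = g.
Proof.
case: f g => [f cf] [g cg] /= fg.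
have {}fg : f = g by exact: functional_extensionality_dep.
case: _ / fg in cg *.
case: cf cg => [[fA] [fZ]] [[gA] [gZ]].
by rewrite (Prop_irrelevance fA gA) (Prop_irrelevance fZ gZ).
Qed.

Section EndoRing.
Variables (R : pzRingType) (M : lmodType R).

Definition endo : Type := {linear M -> M}.
Definition endo_fun (f : endo) : {linear M -> M} := f.

HB.instance Definition _ := gen_eqMixin endo.
HB.instance Definition _ := gen_choiceMixin endo.

Lemma endo_eqP (f g : endo) : endo_fun f =1 endo_fun g -> f = g.
Proof. exact: linear_eqP. Qed.

Definition endo_zero : endo := (\0 : {linear M -> M}).
Definition endo_add (f g : endo) : endo :=
  (endo_fun f \+ endo_fun g : {linear M -> M}).
Definition endo_opp (f : endo) : endo := (\- endo_fun f : {linear M -> M}).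
Definition endo_one : endo := (idfun : {linear M -> M}).
Definition endo_mul (f g : endo) : endo :=
  (endo_fun f \o endo_fun g : {linear M -> M}).

Let endo_addA : associative endo_add.
Proof. by move=> f g h; apply: endo_eqP => x; exact: addrA. Qed.
Let endo_addC : commutative endo_add.
Proof. by move=> f g; apply: endo_eqP => x; exact: addrC. Qed.
Let endo_add0 : left_id endo_zero endo_add.
Proof. by move=> f; apply: endo_eqP => x; exact: add0r. Qed.
Let endo_addN : left_inverse endo_zero endo_opp endo_add.
Proof. by move=> f; apply: endo_eqP => x; exact: addNr. Qed.

HB.instance Definition _ :=
  GRing.isZmodule.Build endo endo_addA endo_addC endo_add0 endo_addN.

Let endo_mulA : associative endo_mul.
Proof. by move=> f g h; exact: endo_eqP. Qed.
Let endo_mul1 : left_id endo_one endo_mul.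
Proof. by move=> f; exact: endo_eqP. Qed.
Let endo_mulr1 : right_id endo_one endo_mul.
Proof. by move=> f; exact: endo_eqP. Qed.
Let endo_mulDl : left_distributive endo_mul +%R.
Proof. by move=> f g h; exact: endo_eqP. Qed.
Let endo_mulDr : right_distributive endo_mul +%R.
Proof. by move=> f g h; apply: endo_eqP => x; exact: (raddfD (endo_fun f)). Qed.

HB.instance Definition _ := GRing.Zmodule_isPzRing.Build endo
  endo_mulA endo_mul1 endo_mulr1 endo_mulDl endo_mulDr.
End EndoRing.

Section EndoAlgebra.
Variables (K : fieldType) (A : kalgType K) (M : lmodType A).

Section Homothety.
Variable k : K.
Definition homothety (x : M) : M := (kalg_in k : A) *: x.

Let homothety_linear : linear homothety.
Proof.
by move=> a x y; rewrite /homothety scalerDr !scalerA kalg_inC.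
Qed.
HB.instance Definition _ :=
  GRing.isLinear.Build A M M *:%R homothety homothety_linear.
End Homothety.

Definition endo_in (k : K) : endo M := (homothety k : {linear M -> M}).

Let endo_in_zmod : zmod_morphism endo_in.
Proof.
move=> k l; apply: endo_eqP => x.
by rewrite /= /homothety raddfB scalerBl.
Qed.
Let endo_in_monoid : monoid_morphism endo_in.
Proof.
split=> [|k l]; apply: endo_eqP => x; rewrite /= /homothety.
  by rewrite rmorph1 scale1r.
by rewrite scalerA rmorphM.
Qed.

HB.instance Definition _ :=
  GRing.isZmodMorphism.Build K (endo M) endo_in endo_in_zmod.
HB.instance Definition _ :=
  GRing.isMonoidMorphism.Build K (endo M) endo_in endo_in_monoid.

Let endo_inC k (f : endo M) : endo_in k * f = f * endo_in k.
Proof.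
by apply: endo_eqP => x; rewrite /= /homothety linearZ.
Qed.

HB.instance Definition _ := isKAlgebra.Build K (endo M) endo_inC.
End EndoAlgebra.

Record quiver := Quiver {
  vertex : finType;
  arrow : finType;
  src : arrow -> vertex;
  tgt : arrow -> vertex }.

Section Paths.
Variable Q : quiver.

(* Paths are composed from right to left: [v] is the end point of the path and
   [s = [:: a_1; ...; a_r]] lists its arrows, with [tgt a_(i+1) = src a_i]. *)
Fixpoint is_path (v : vertex Q) (s : seq (arrow Q)) : bool :=
  if s is a :: s' then (tgt a == v) && is_path (src a) s' else true.

Definition qpath := {x : vertex Q * seq (arrow Q) | is_path x.1 x.2}.
HB.instance Definition _ := SubType.on qpath.
HB.instance Definition _ := Choice.on qpath.

Definition path_tgt (p : qpath) : vertex Q := (val p).1.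
Definition path_arrows (p : qpath) : seq (arrow Q) := (val p).2.
Definition path_src (p : qpath) : vertex Q :=
  last (path_tgt p) (map (@src Q) (path_arrows p)).
Definition path_length (p : qpath) : nat := size (path_arrows p).

Definition vertex_path (v : vertex Q) : qpath := exist _ (v, [::]) isT.

Lemma arrow_is_path (a : arrow Q) : is_path (tgt a) [:: a].
Proof. by rewrite /= eqxx. Qed.
Definition arrow_path (a : arrow Q) : qpath :=
  exist _ (tgt a, [:: a]) (arrow_is_path a).

Lemma is_path_cat v s t :
  is_path v (s ++ t) = is_path v s && is_path (last v (map (@src Q) s)) t.
Proof. by elim: s v => //= a s IHs v; rewrite IHs andbA. Qed.

(* By [is_path_cat] the [insub] below never fails. *)
Definition path_mul (p q : qpath) : option qpath :=
  if path_src p == path_tgt q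
  then insub (path_tgt p, path_arrows p ++ path_arrows q) : option qpath
  else None.

Lemma path_mulP p q :
  if path_src p == path_tgt q then
    exists2 r, path_mul p q = Some r &
      [/\ path_tgt r = path_tgt p, path_src r = path_src q
        & path_arrows r = path_arrows p ++ path_arrows q]
  else path_mul p q = None.
Proof.
rewrite /path_mul; case: eqP => // pq.
have pP : is_path (path_tgt p) (path_arrows p) := valP p.
have qP : is_path (path_tgt q) (path_arrows q) := valP q.
have rP : is_path (path_tgt p) (path_arrows p ++ path_arrows q).
  by rewrite is_path_cat pP -/(path_src p) pq.
exists (exist _ (path_tgt p, path_arrows p ++ path_arrows q) rP).
  by rewrite insubT.
split=> //; rewrite /path_src /path_arrows /path_tgt /= map_cat last_cat.
by rewrite -/(path_tgt p) -/(path_arrows p) -/(path_src p) pq.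
Qed.

Lemma qpath_eq (p q : qpath) :
  path_tgt p = path_tgt q -> path_arrows p = path_arrows q -> p = q.
Proof.
rewrite /path_tgt /path_arrows => pq1 pq2; apply: val_inj.
by case: (val p) (val q) pq1 pq2 => [? ?] [? ?] /= -> ->.
Qed.

Lemma path_mulA p q r :
  obind (path_mul^~ r) (path_mul p q) = obind (path_mul p) (path_mul q r).
Proof.
have := path_mulP p q; have := path_mulP q r.
case: eqP => [qr [u -> [u1 u2 u3]]|qr ->]; case: eqP => [pq [w -> [w1 w2 w3]]|pq ->] //=.
- have := path_mulP w r; have := path_mulP p u.
  rewrite u1 w2 qr pq !eqxx => -[x -> [x1 x2 x3]] [y -> [y1 y2 y3]].
  congr Some; apply: qpath_eq; first by rewrite x1 y1 w1.
  by rewrite x3 y3 u3 w3 catA.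
- by have := path_mulP p u; rewrite u1; case: eqP.
- by have := path_mulP w r; rewrite w2; case: eqP.
Qed.
End Paths.

Section PathAlgebra.
Variables (K : fieldType) (Q : quiver).

Definition path_alg : Type := {malg K[qpath Q]}.

HB.instance Definition _ := GRing.Zmodule.on path_alg.

Implicit Types (x y z : path_alg) (p q r : qpath Q) (k : K).

Fact palg_key : unit. Proof. exact: tt. Qed.

Definition path_elt_def p : path_alg := << p >>.
Definition path_elt := locked_with palg_key path_elt_def.
Lemma path_eltE p : path_elt p = << p >>.
Proof. by rewrite [path_elt]unlock. Qed.

Definition arrow_elt (a : arrow Q) : path_alg := path_elt (arrow_path a).

Definition mul_paths p q : path_alg :=
  if path_mul p q is Some r then path_elt r else 0.

Definition palg_scale_def k x : path_alg := k *: (x : {malg K[qpath Q]}).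
Definition palg_scale := locked_with palg_key palg_scale_def.
Lemma palg_scaleE k x : palg_scale k x = k *: (x : {malg K[qpath Q]}).
Proof. by rewrite [palg_scale]unlock. Qed.

Definition palg_mul_def x y : path_alg :=
  \sum_(p <- msupp x) \sum_(q <- msupp y)
    palg_scale (mcoeff p x * mcoeff q y) (mul_paths p q).
Definition palg_mul := locked_with palg_key palg_mul_def.

Lemma palg_mulE x y : palg_mul x y =
  \sum_(p <- msupp x) \sum_(q <- msupp y)
    palg_scale (mcoeff p x * mcoeff q y) (mul_paths p q).
Proof. by rewrite [palg_mul]unlock. Qed.

Definition palg_one : path_alg :=
  \sum_(v : vertex Q) path_elt (vertex_path v).

Let mulE (d1 d2 : {fset qpath Q}) x y :
  (msupp x `<=` d1)%fset -> (msupp y `<=` d2)%fset ->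
  palg_mul x y = \sum_(p <- d1) \sum_(q <- d2)
    palg_scale (mcoeff p x * mcoeff q y) (mul_paths p q).
Proof.
move=> sx sy; rewrite palg_mulE (big_fset_incl _ sx) /=; last first.
  move=> p _ /mcoeff_outdom xp0; apply: big1 => q _.
  by rewrite xp0 mul0r ?palg_scaleE scale0r.
apply: eq_bigr => p _; rewrite (big_fset_incl _ sy) //= => q _.
by move=> /mcoeff_outdom yq0; rewrite yq0 mulr0 ?palg_scaleE scale0r.
Qed.

Let mulDl : left_distributive palg_mul +%R.
Proof.
move=> x y z; pose d1 := (msupp x `|` msupp y)%fset.
rewrite (@mulE d1 (msupp z)) ?msuppD_le //.
rewrite (@mulE d1 (msupp z) x) ?fsubsetUl //.
rewrite (@mulE d1 (msupp z) y) ?fsubsetUr //.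
rewrite -big_split; apply: eq_bigr => p _; rewrite -big_split.
by apply: eq_bigr => q _; rewrite mcoeffD mulrDl ?palg_scaleE scalerDl.
Qed.

Let mulDr : right_distributive palg_mul +%R.
Proof.
move=> z x y; pose d2 := (msupp x `|` msupp y)%fset.
rewrite (@mulE (msupp z) d2) ?msuppD_le //.
rewrite (@mulE (msupp z) d2 z x) ?fsubsetUl //.
rewrite (@mulE (msupp z) d2 z y) ?fsubsetUr //.
rewrite -big_split; apply: eq_bigr => p _; rewrite -big_split.
by apply: eq_bigr => q _; rewrite mcoeffD mulrDr ?palg_scaleE scalerDl.
Qed.

Let mul0x y : palg_mul 0 y = 0.
Proof. by apply: (@addrI _ (palg_mul 0 y)); rewrite -mulDl !addr0. Qed.
Let mulx0 x : palg_mul x 0 = 0.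
Proof. by apply: (@addrI _ (palg_mul x 0)); rewrite -mulDr !addr0. Qed.

Let mul_suml (I : Type) (s : seq I) (P : pred I) (F : I -> path_alg) y :
  palg_mul (\sum_(i <- s | P i) F i) y = \sum_(i <- s | P i) palg_mul (F i) y.
Proof. by apply: (big_morph (palg_mul^~ y)) => [u v|]; [exact: mulDl|]. Qed.
Let mul_sumr (I : Type) (s : seq I) (P : pred I) (F : I -> path_alg) x :
  palg_mul x (\sum_(i <- s | P i) F i) = \sum_(i <- s | P i) palg_mul x (F i).
Proof. by apply: (big_morph (palg_mul x)) => [u v|]; [exact: mulDr|]. Qed.

Let mulZl k x y : palg_mul (palg_scale k x) y = palg_scale k (palg_mul x y).
Proof.
rewrite (@mulE (msupp x) (msupp y)) ?palg_scaleE ?msuppZ_le // palg_mulE.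
rewrite [RHS]scaler_sumr.
apply: eq_bigr => p _; rewrite scaler_sumr; apply: eq_bigr => q _.
by rewrite mcoeffZ !palg_scaleE scalerA mulrA.
Qed.
Let mulZr k x y : palg_mul x (palg_scale k y) = palg_scale k (palg_mul x y).
Proof.
rewrite (@mulE (msupp x) (msupp y)) ?palg_scaleE ?msuppZ_le // palg_mulE.
rewrite [RHS]scaler_sumr.
apply: eq_bigr => p _; rewrite scaler_sumr; apply: eq_bigr => q _.
by rewrite mcoeffZ !palg_scaleE scalerA mulrCA.
Qed.

Lemma palg_mulUU p q : palg_mul (path_elt p) (path_elt q) = mul_paths p q.
Proof.
rewrite (@mulE [fset p]%fset [fset q]%fset) ?path_eltE ?msuppU_le // -!path_eltE.
rewrite (big_seq_fset1 _ p) (big_seq_fset1 _ q).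
have cE t : mcoeff t (path_elt t) = 1 by rewrite path_eltE; exact: mcoeffUU.
by rewrite !cE mulr1 ?palg_scaleE scale1r.
Qed.

Lemma palgE x :
  x = \sum_(p <- msupp x) palg_scale (mcoeff p x) (path_elt p).
Proof.
have scaleU c p : palg_scale c (path_elt p) = << c *g p >>.
  apply/malgP => q; transitivity (c * mcoeff q (path_elt p)).
    by rewrite palg_scaleE; exact: mcoeffZ.
  transitivity (c * (1 *+ (p == q))).
    by congr (_ * _); rewrite path_eltE; exact: mcoeffU.
  transitivity (c *+ (p == q)); first by rewrite mulr_natr.
  exact/esym/mcoeffU.
by rewrite {1}[x]monalgE; apply: eq_bigr => p _; rewrite scaleU.
Qed.

Lemma palg_ind (P : path_alg -> Prop) :
  P 0 -> (forall x y, P x -> P y -> P (x + y)) ->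
  (forall k x, P x -> P (palg_scale k x)) -> (forall p, P (path_elt p)) ->
  forall x, P x.
Proof.
move=> P0 PD PZ Pp x; rewrite [x]palgE; elim/big_ind: _ => // p _.
exact/PZ/Pp.
Qed.

Let mul_paths_mull p q r :
  palg_mul (mul_paths p q) (path_elt r) =
  if obind (@path_mul Q ^~ r) (path_mul p q) is Some t then path_elt t else 0.
Proof.
by rewrite /mul_paths; case: (path_mul p q) => [t|] /=; rewrite ?palg_mulUU ?mul0x.
Qed.
Let mul_paths_mulr p q r :
  palg_mul (path_elt p) (mul_paths q r) =
  if obind (path_mul p) (path_mul q r) is Some t then path_elt t else 0.
Proof.
by rewrite /mul_paths; case: (path_mul q r) => [t|] /=; rewrite ?palg_mulUU ?mulx0.
Qed.

Let mulA : associative palg_mul.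
Proof.
elim/palg_ind=> [y z|x x' IH IH' y z|k x IH y z|p].
- by rewrite !mul0x.
- by rewrite !mulDl IH IH'.
- by rewrite !mulZl IH.
elim/palg_ind=> [z|y y' IH IH' z|k y IH z|q].
- by rewrite !(mul0x, mulx0).
- by rewrite !(mulDl, mulDr) IH IH'.
- by rewrite (mulZl k y z) (mulZr k (path_elt p)) (mulZr k (path_elt p) y) mulZl IH.
elim/palg_ind=> [|z z' IH IH'|k z IH|r].
- by rewrite !mulx0.
- by rewrite !mulDr IH IH'.
- by rewrite !mulZr IH.
by rewrite !palg_mulUU mul_paths_mulr mul_paths_mull path_mulA.
Qed.

Let vertex_mul v q :
  mul_paths (vertex_path v) q = if v == path_tgt q then path_elt q else 0.
Proof.
rewrite /mul_paths; have := path_mulP (vertex_path v) q.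
have -> : path_src (vertex_path v) = v by [].
case: eqP => [->|_ ->//] [r -> [r1 r2 r3]].
by congr path_elt; apply: qpath_eq.
Qed.
Let mul_vertex v q :
  mul_paths q (vertex_path v) = if v == path_src q then path_elt q else 0.
Proof.
rewrite /mul_paths; have := path_mulP q (vertex_path v).
have -> : path_tgt (vertex_path v) = v by [].
rewrite eq_sym.
case: eqP => [->|_ ->//] [r -> [r1 r2 r3]].
by congr path_elt; apply: qpath_eq => //; rewrite r3 cats0.
Qed.

Let mul1 : left_id palg_one palg_mul.
Proof.
elim/palg_ind=> [|x y IHx IHy|k x IH|p].
- exact: mulx0.
- by rewrite mulDr IHx IHy.
- by rewrite mulZr IH.
rewrite mul_suml (bigD1 (path_tgt p)) //= big1 => [|v vp].
  by rewrite addr0 palg_mulUU vertex_mul eqxx.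
by rewrite palg_mulUU vertex_mul (negPf vp).
Qed.
Let mulr1 : right_id palg_one palg_mul.
Proof.
elim/palg_ind=> [|x y IHx IHy|k x IH|p].
- exact: mul0x.
- by rewrite mulDl IHx IHy.
- by rewrite mulZl IH.
rewrite mul_sumr (bigD1 (path_src p)) //= big1 => [|v vp].
  by rewrite addr0 palg_mulUU mul_vertex eqxx.
by rewrite palg_mulUU mul_vertex (negPf vp).
Qed.

HB.instance Definition _ := GRing.Zmodule_isPzRing.Build path_alg
  mulA mul1 mulr1 mulDl mulDr.

Lemma path_eltM p q : path_elt p * path_elt q = mul_paths p q.
Proof. exact: palg_mulUU. Qed.

Definition palg_in k : path_alg := palg_scale k 1.

Lemma palg_inM k x : palg_in k * x = palg_scale k x.
Proof. by rewrite [LHS]mulZl [palg_mul _ _]mul1r. Qed.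
Lemma palg_Min k x : x * palg_in k = palg_scale k x.
Proof. by rewrite [LHS]mulZr [palg_mul _ _]mulr1. Qed.

Let palg_in_zmod : zmod_morphism palg_in.
Proof. by move=> k l; rewrite /palg_in !palg_scaleE; exact: scalerBl. Qed.
Let palg_in_monoid : monoid_morphism palg_in.
Proof.
split; first by rewrite /palg_in palg_scaleE scale1r.
by move=> k l; rewrite palg_inM /palg_in !palg_scaleE scalerA.
Qed.

HB.instance Definition _ :=
  GRing.isZmodMorphism.Build K path_alg palg_in palg_in_zmod.
HB.instance Definition _ :=
  GRing.isMonoidMorphism.Build K path_alg palg_in palg_in_monoid.

Let palg_inC k x : palg_in k * x = x * palg_in k.
Proof. by rewrite palg_inM palg_Min. Qed.

HB.instance Definition _ := isKAlgebra.Build K path_alg palg_inC.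
End PathAlgebra.

Section BoundQuiver.
Variables (K : fieldType) (Q : quiver).

(* A set of zero relations of length 2: [I b a] means that the path [b a]
   (first [a], then [b]) belongs to the set. *)
Implicit Types I : rel (arrow Q).

Definition relation_elt I (x : path_alg K Q) : Prop :=
  exists b a : arrow Q, I b a /\ x = arrow_elt K b * arrow_elt K a.

Definition relation_ideal I : ideal (path_alg K Q) :=
  gen_ideal (relation_elt I).

Definition bound_quiver_alg I : kalgType K := quot_alg (relation_ideal I).

(* The m-th power of the arrow ideal, for m >= 1. *)
Definition arrow_ideal_pow (m : nat) : ideal (path_alg K Q) :=
  gen_ideal (fun x => exists p, path_length p = m /\ x = path_elt K p).

Definition admissible (J : ideal (path_alg K Q)) : Prop :=
  (forall x, J x -> arrow_ideal_pow 2 x) /\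
  exists2 m : nat, (2 <= m)%N & forall x, arrow_ideal_pow m x -> J x.

Definition gentle I : Prop :=
  [/\ (forall b a, I b a -> tgt a = src b),
      admissible (relation_ideal I),
      (forall v : vertex Q,
         (#|[pred a : arrow Q | src a == v]| <= 2)%N /\
         (#|[pred a : arrow Q | tgt a == v]| <= 2)%N),
      (forall a b b' : arrow Q,
         (tgt b = src a -> ~~ I a b -> tgt b' = src a -> ~~ I a b' -> b = b') /\
         (src b = tgt a -> ~~ I b a -> src b' = tgt a -> ~~ I b' a -> b = b'))
    & (forall a b b' : arrow Q,
         (tgt b = src a -> I a b -> tgt b' = src a -> I a b' -> b = b') /\
         (src b = tgt a -> I b a -> src b' = tgt a -> I b' a -> b = b'))].

End BoundQuiver.

Section GorensteinProjective.
Variable R : pzRingType.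

Definition Gproj (G : lmodType R) : Prop :=
  fin_generated G /\
  exists (P : int -> lmodType R) (d : forall i : int, {linear P i -> P (i + 1)}),
    [/\ (forall i, fin_generated (P i) /\ projective (P i)),
        (forall i (x : P (i + 1)), d (i + 1) x = 0 <-> exists y, x = d i y),
        (forall i (f : {linear P (i + 1) -> R^o}),
           (forall x, f (d i x) = 0) <->
           exists g : {linear P (i + 1 + 1) -> R^o}, forall x, f x = g (d (i + 1) x))
      & exists2 e : {linear G -> P 0}, injective e &
          forall x, d 0 x = 0 <-> exists y, x = e y].

(* [E] lists, up to isomorphism and without repetition, the indecomposable
   Gorenstein projective modules. *)
Definition indec_Gproj_list (n : nat) (E : 'I_n -> lmodType R) : Prop :=
  [/\ (forall i, Gproj (E i) /\ indecomposable (E i)),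
      (forall i j, mod_iso (E i) (E j) -> i = j)
    & (forall M : lmodType R, Gproj M -> indecomposable M ->
         exists i, mod_iso M (E i))].

Definition CM_finite : Prop :=
  exists (n : nat) (E : 'I_n -> lmodType R), indec_Gproj_list E.

End GorensteinProjective.

Definition Aus (K : fieldType) (A : kalgType K) (n : nat)
    (E : 'I_n -> lmodType A) : kalgType K :=
  (endo (dsum E))^c.

Section AusQuiver.
Variables (Q : quiver) (I : rel (arrow Q)).

(* [c = [:: a_1; ...; a_n]] represents an element of C(Lambda): n >= 1, the
   a_i are pairwise distinct, and a_i a_(i+1) and a_n a_1 belong to I. *)
Definition relation_cycle (c : seq (arrow Q)) : Prop :=
  [/\ c != [::], uniq c & cycle I c].

(* Lying on a cycle does not depend on its representative up to rotation. *)
Definition cyclic_arrow (a : arrow Q) : bool :=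
  `[< exists2 c, relation_cycle c & a \in c >].

Definition cyc_arrow : finType := {a : arrow Q | cyclic_arrow a}.
Definition ncyc_arrow : finType := {a : arrow Q | ~~ cyclic_arrow a}.

Definition aus_vertex : finType := (vertex Q + cyc_arrow)%type.

(* The three summands are the non-cyclic arrows, the a^+ and the a^-. *)
Definition aus_arrow : finType := (ncyc_arrow + (cyc_arrow + cyc_arrow))%type.

Definition aus_src (x : aus_arrow) : aus_vertex :=
  match x with
  | inl a => inl (src (val a))
  | inr (inl a) => inl (src (val a))
  | inr (inr a) => inr a
  end.

Definition aus_tgt (x : aus_arrow) : aus_vertex :=
  match x with
  | inl a => inl (tgt (val a))
  | inr (inl a) => inr a
  | inr (inr a) => inl (tgt (val a))
  end.

Definition aus_quiver : quiver := Quiver aus_src aus_tgt.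

Definition aus_rel : rel (arrow aus_quiver) := fun x y : aus_arrow =>
  match x, y with
  | inl b, inl a => I (val b) (val a)
  | inr (inl b), inr (inr a) => I (val b) (val a)
  | _, _ => false
  end.

End AusQuiver.

Arguments aus_rel {Q} I.

(* Main.v *)
(**
Paths without a subpath in I form a basis of the gentle algebra Lambda, because the relations are
monomial.  Reading off these coordinates, if an arrow b kills an element of e_(src b) M, where M is
torsionless, then every functional sends that element into a Lambda, where a is the unique arrow
with b a in I (to 0 if there is none).  Generate a finitely generated M by elements each spanning a
quotient of some Lambda e_v or some Lambda a, as few as possible and then with as few of the first
kind as possible.  By Nakayama's lemma they satisfy no further relations, so M is a direct sum of
modules Lambda e_v and Lambda a.  In particular an indecomposable Gorenstein projective module is
some Lambda e_v or some nonprojective Lambda a.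

The syzygy of Lambda a is Lambda b for the arrow b with b a in I.  If Lambda a is Gorenstein
projective, comparison with a complete resolution shows that maps from each of its syzygies to
Lambda extend to the projective cover, which fails when the syzygy is a projective Lambda b.  So
the chain of arrows never ends, and by uniqueness and finiteness it closes up to a relation cycle
through a.  Conversely a relation cycle yields a complete resolution.

Every map between these indecomposables is right multiplication by an element of Lambda, hence a
combination of paths of Q.  A path of the Auslander quiver determines a path of Q by erasing the
a^+ and reading a^- as a; between fixed end points this is a bijection onto the paths occurring in
the corresponding Hom space, and it matches the nonzero paths on both sides.
*)

From HB Require Import structures.
From mathcomp Require Import all_boot all_algebra.
From mathcomp Require Import boolp finmap monalg.
Require Import Defs.

Set Implicit Arguments.
Unset Strict Implicit.
Unset Printing Implicit Defensive.

Import GRing.Theory.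
Local Open Scope ring_scope.

(** * Modules, syzygies and Gorenstein projectives *)

Section LinearMaps.
Variable R : pzRingType.
Implicit Types M N P X Y : lmodType R.

Definition lin_of M N (f : M -> N) (fL : linear f) : {linear M -> N} :=
  HB.pack f (GRing.isLinear.Build R M N *:%R f fL).

Lemma lin_ofE M N (f : M -> N) (fL : linear f) x : lin_of fL x = f x.
Proof. by []. Qed.

Lemma mod_isoP M N : mod_iso M N <->
  exists (f : {linear M -> N}) (g : {linear N -> M}), cancel f g /\ cancel g f.
Proof.
split=> [[f [g fg gf]]|[f [g [fg gf]]]]; last by exists f; exists g.
have gL : linear g.
  by move=> a x y; apply: (can_inj fg); rewrite linearP !gf.
by exists f, (lin_of gL).
Qed.

Lemma mod_iso_sym M N : mod_iso M N -> mod_iso N M.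
Proof. by move=> /mod_isoP[f [g [fg gf]]]; apply/mod_isoP; exists g, f. Qed.

Lemma mod_iso_trans M N P : mod_iso M N -> mod_iso N P -> mod_iso M P.
Proof.
move=> [f fB] [g gB]; exists (g \o f : {linear M -> P}); exact: bij_comp.
Qed.

Lemma linear_bij X Y (f : {linear X -> Y}) :
  (forall x, f x = 0 -> x = 0) -> (forall y, exists x, y = f x) -> mod_iso X Y.
Proof.
move=> f0 /choice[h hE]; exists f, h => x; last by rewrite -hE.
by apply/subr0_eq/f0; rewrite linearB /= -hE subrr.
Qed.

Lemma factor_inj N P Y (i : {linear N -> P}) (h : {linear Y -> P}) :
  injective i -> (forall y, exists n, h y = i n) ->
  exists k : {linear Y -> N}, forall y, i (k y) = h y.
Proof.
move=> iI /choice[k kP].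
have kL : linear k by move=> a x y; apply: iI; rewrite -kP !linearP !kP.
by exists (lin_of kL) => y; rewrite lin_ofE.
Qed.

Record submodule M := Submodule {
  smem :> M -> Prop;
  smem0 : smem 0;
  smemD : forall x y, smem x -> smem y -> smem (x + y);
  smemZ : forall a x, smem x -> smem (a *: x) }.

End LinearMaps.

Section SubmoduleType.
Variables (R : pzRingType) (M : lmodType R) (S : submodule M).

(** Deciding membership classically gives a boolean predicate, so that the submodule can be built as
    a subtype. *)
Definition smem_pred : {pred M} := fun x => `[< S x >].

Lemma smem_closed : submod_closed smem_pred.
Proof.
split=> [|a x y /asboolP Sx /asboolP Sy]; apply/asboolP; first exact: smem0.
by apply: smemD => //; exact: smemZ.
Qed.

HB.instance Definition _ := GRing.isSubmodClosed.Build R M smem_pred smem_closed.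

Definition submod : Type := {x : M | x \in smem_pred}.
HB.instance Definition _ := SubType.on submod.
HB.instance Definition _ := Choice.on submod.
HB.instance Definition _ := [SubChoice_isSubLmodule of submod by <:].

Definition sub_val : {linear submod -> M} := val : submod -> M.

Lemma sub_valP (x : submod) : S (sub_val x).
Proof. exact/asboolP/(valP x). Qed.

Lemma sub_val_inj : injective sub_val. Proof. exact: val_inj. Qed.

Definition smk x (Sx : S x) : submod := exist _ x (introT (asboolP _) Sx).

Lemma smkK x (Sx : S x) : sub_val (smk Sx) = x. Proof. by []. Qed.

Lemma sub_valE x : S x <-> exists y : submod, x = sub_val y.
Proof. by split=> [Sx|[y ->]]; [exists (smk Sx)|exact: sub_valP]. Qed.

Lemma corestrict (Y : lmodType R) (h : {linear Y -> M}) : (forall y, S (h y)) ->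
  exists k : {linear Y -> submod}, forall y, sub_val (k y) = h y.
Proof. by move=> hS; apply: factor_inj sub_val_inj _ => y; apply/sub_valE. Qed.

End SubmoduleType.
Arguments sub_val {R M S}.

Section Kernel.
Variables (R : pzRingType) (M N : lmodType R) (f : {linear M -> N}).

Let kern0 : f 0 = 0. Proof. exact: linear0. Qed.
Let kernD x y : f x = 0 -> f y = 0 -> f (x + y) = 0.
Proof. by rewrite linearD => -> ->; rewrite addr0. Qed.
Let kernZ a x : f x = 0 -> f (a *: x) = 0.
Proof. by rewrite linearZ => ->; exact: scaler0. Qed.

Definition kern : submodule M := Submodule kern0 kernD kernZ.
End Kernel.

Section Syzygies.
Variable R : pzRingType.
Implicit Types M N P X Y G : lmodType R.

Definition torsionless M : Prop :=
  forall x : M, (forall f : {linear M -> R^o}, f x = 0) -> x = 0.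

Lemma comb_linear n M (g : 'I_n -> M) :
  linear (fun c : dsum (fun _ : 'I_n => (R^o : lmodType R)) => \sum_(i < n) (c i : R) *: g i).
Proof.
move=> a c d; rewrite scaler_sumr -big_split; apply: eq_bigr => i _.
by rewrite scalerA; exact: scalerDl.
Qed.

Lemma dsum_proj_linear n (E : 'I_n -> lmodType R) i : linear (fun c : dsum E => c i).
Proof. by []. Qed.

Definition dsum_proj n (E : 'I_n -> lmodType R) i : {linear dsum E -> E i} :=
  lin_of (@dsum_proj_linear n E i).

Definition dsum_inj n (E : 'I_n -> lmodType R) i (x : E i) : dsum E :=
  dfwith (0 : dsum E) x.

Lemma dsum_inj_in n (E : 'I_n -> lmodType R) i (x : E i) : dsum_inj x i = x.
Proof. exact: dfwith_in. Qed.

Lemma dsum_inj_out n (E : 'I_n -> lmodType R) i j (x : E i) : i != j -> dsum_inj x j = 0.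
Proof. exact: dfwith_out. Qed.

Lemma dsum_inj_linear n (E : 'I_n -> lmodType R) i : linear (@dsum_inj n E i).
Proof.
move=> a x y; apply: functional_extensionality_dep => j.
have -> : (a *: dsum_inj x + dsum_inj y) j = a *: dsum_inj x j + dsum_inj y j by [].
have [<-|ij] := eqVneq i j; first by rewrite !dsum_inj_in.
by rewrite !dsum_inj_out // scaler0 addr0.
Qed.

(** A surjection from a finite free module onto [P] splits, and the coordinates of the splitting are
    functionals that separate points. *)
Lemma projective_torsionless P : fin_generated P -> projective P -> torsionless P.
Proof.
move=> [n [g gP]] /(_ _ _ (lin_of (comb_linear g)) idfun)[|s sP x x0].
  by move=> y; have [c ->] := gP y; exists c.
rewrite -[x]/(idfun x) -sP (_ : s x = 0) ?linear0 //.
apply: functional_extensionality_dep => i.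
exact: (x0 (dsum_proj _ i \o s : {linear P -> R^o})).
Qed.

Lemma Gproj_torsionless G : Gproj G -> torsionless G.
Proof.
case=> _ [P [d [PP _ _ [e eI _]]]] x x0; apply: eI; rewrite linear0.
have [P0 P1] := PP 0; apply: (projective_torsionless P0 P1) => f.
exact: (x0 (f \o e : {linear G -> R^o})).
Qed.

Lemma fin_generated_iso M N : mod_iso M N -> fin_generated N -> fin_generated M.
Proof.
move=> /mod_isoP[f [h [fh hf]]] [n [g gP]]; exists n, (h \o g) => x.
have [c cE] := gP (f x); exists c; rewrite -[x]fh cE linear_sum.
by apply: eq_bigr => i _; rewrite linearZ.
Qed.

Lemma Gproj_iso M N : mod_iso M N -> Gproj N -> Gproj M.
Proof.
move=> MN [Nf [P [d [PP ex hex [e eI ek]]]]]; split; first exact: fin_generated_iso Nf.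
have /mod_isoP[f [h [fh hf]]] := MN.
exists P, d; split=> //; exists (e \o f : {linear M -> P 0}).
  exact: inj_comp eI (can_inj fh).
move=> x; rewrite ek; split=> [[y ->]|[y ->]]; last by exists (f y).
by exists (h y); rewrite /= hf.
Qed.

Lemma projective_prod M N : projective M -> projective N -> projective (M * N)%type.
Proof.
move=> Mp Np X Y p f pS.
have inlL : linear (fun m : M => (m, 0) : M * N).
  by move=> a m n; apply: injective_projections; rewrite //= scaler0 addr0.
have inrL : linear (fun n : N => (0, n) : M * N).
  by move=> a m n; apply: injective_projections; rewrite //= scaler0 addr0.
have [g gE] := Mp _ _ p (f \o lin_of inlL : {linear M -> Y}) pS.
have [h hE] := Np _ _ p (f \o lin_of inrL : {linear N -> Y}) pS.
have kL : linear (fun u : M * N => g u.1 + h u.2).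
  by move=> a u v; rewrite !linearP scalerDr addrACA.
exists (lin_of kL) => -[m n]; rewrite lin_ofE linearD gE hE /= -linearD.
by congr (f (_, _)); rewrite ?addr0 ?add0r.
Qed.

Lemma fin_generated_prod M N :
  fin_generated M -> fin_generated N -> fin_generated (M * N)%type.
Proof.
move=> [m [g gP]] [n [h hP]].
exists (m + n)%N, (fun i => match split i with inl j => (g j, 0) | inr j => (0, h j) end).
move=> [x y]; have [c cE] := gP x; have [d dE] := hP y.
exists (fun i => match split i with inl j => c j | inr j => d j end).
rewrite big_split_ord /=.
under eq_bigr => i _ do rewrite (unsplitK (inl i)).
under [X in _ = _ + X]eq_bigr => i _ do rewrite (unsplitK (inr i)).
apply: injective_projections; rewrite /= !raddf_sum /=.
  by rewrite {1}cE [X in _ = _ + X]big1 ?addr0 // => i _; rewrite scaler0.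
by rewrite {1}dE [X in _ = X + _]big1 ?add0r // => i _; rewrite scaler0.
Qed.

(* [M] is a syzygy of the contractible complex [M * M -> M * M, (x, y) |-> (y, 0)]. *)
Lemma projective_Gproj M : fin_generated M -> projective M -> Gproj M.
Proof.
move=> Mf Mp; split=> //.
have dL : linear (fun u : M * M => (u.2, 0) : M * M).
  by move=> a u v; apply: injective_projections; rewrite //= scaler0 addr0.
have eL : linear (fun m : M => (m, 0) : M * M).
  by move=> a m n; apply: injective_projections; rewrite //= scaler0 addr0.
exists (fun=> (M * M)%type : lmodType R), (fun=> lin_of dL); split.
- by split; [exact: fin_generated_prod|exact: projective_prod].
- move=> _ [x y]; rewrite lin_ofE; split=> [[->]|[[x' y']]]; last first.
    by rewrite lin_ofE => -[_ ->].
  by exists (0, x); rewrite lin_ofE.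
- move=> _ f; split=> [f0|[g gE] x]; last first.
    by rewrite gE -[RHS](linear0 g); congr (g _); rewrite !lin_ofE.
  (* The functional [f] vanishes on the first factor, so [f (x, y)] depends only on [y], which is
     recovered from [(y, 0)] by moving it back to the second coordinate. *)
  have sL : linear (fun u : M * M => (0, u.1) : M * M).
    by move=> a u v; apply: injective_projections; rewrite //= scaler0 addr0.
  exists (f \o lin_of sL : {linear (M * M)%type -> R^o}) => -[x y].
  change (f (x, y) = f (0, y)); rewrite -[LHS]subr0 -(f0 (y, x)) -linearB.
  by congr (f (_, _)); rewrite ?subrr ?subr0.
exists (lin_of eL) => [x y [] //|[x y]].
rewrite !lin_ofE; split=> [[->]|[z]]; first by exists x.
by rewrite lin_ofE => -[_ ->].
Qed.

(* [X] is a direct summand of [Y] up to maps through a projective module. *)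
Definition stable_summand X Y : Prop :=
  exists (f : {linear X -> Y}) (g : {linear Y -> X}) (P : lmodType R)
    (u : {linear P -> X}) (v : {linear X -> P}),
    projective P /\ forall x, x = g (f x) + u (v x).

(** When [i] is the syzygy of [X] in a projective module [P], this is the vanishing of Ext^1(X,
    R). *)
Definition extends N P (i : {linear N -> P}) : Prop :=
  forall f : {linear N -> R^o}, exists g : {linear P -> R^o}, forall n, g (i n) = f n.

Definition syzygy N P X (i : {linear N -> P}) (p : {linear P -> X}) : Prop :=
  [/\ projective P, (forall x, exists y, p y = x), injective i
    & forall y, p y = 0 <-> exists n, y = i n].

(** Lift [f] and [g] to maps [a] and [b] between [P] and [P'], and [u] to [w]. Then
    [id - b a - w v p] maps [P] into [N], so the identity of [N] is [bN aN] plus a map through [P].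
    A functional on [N] extends once its composite with [bN] does. *)
Lemma stable_summand_syzygy X Y N P N' P' (i : {linear N -> P}) (p : {linear P -> X})
    (i' : {linear N' -> P'}) (p' : {linear P' -> Y}) :
  syzygy i p -> syzygy i' p' -> stable_summand X Y ->
  stable_summand N N' /\ (extends i' -> extends i).
Proof.
move=> [Pp ps iI ik] [Pp' ps' iI' ik'] [f [g [T [u [v [Tp fgE]]]]]].
have [a aP] := Pp _ _ p' (f \o p : {linear P -> Y}) ps'.
have [b bP] := Pp' _ _ p (g \o p' : {linear P' -> X}) ps.
have [w wP] := Tp _ _ p u ps.
have pi n : p (i n) = 0 by apply/ik; exists n.
have pi' n : p' (i' n) = 0 by apply/ik'; exists n.
have [aN aNP] : exists aN : {linear N -> N'}, forall n, i' (aN n) = a (i n).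
  apply: (factor_inj (h := a \o i : {linear N -> P'})) => // n.
  by apply/ik'; rewrite aP /= pi linear0.
have [bN bNP] : exists bN : {linear N' -> N}, forall n, i (bN n) = b (i' n).
  apply: (factor_inj (h := b \o i' : {linear N' -> P})) => // n.
  by apply/ik; rewrite bP /= pi' linear0.
have [t tP] : exists t : {linear P -> N}, forall x, i (t x) = x - b (a x) - w (v (p x)).
  pose h : {linear P -> P} := (idfun \- (b \o a)) \- (w \o (v \o p)).
  apply: (factor_inj (h := h)) => // x; apply/ik; rewrite /= !linearB /=.
  by rewrite bP /= aP /= wP -addrA -opprD -fgE subrr.
have nE n : n = bN (aN n) + t (i n).
  by apply: iI; rewrite linearD tP bNP aNP pi !linear0 addr0 addrC subrK.
split; first by exists aN, bN, P, t, i.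
move=> ext h; have [k kP] := ext (h \o bN : {linear N' -> R^o}).
exists ((k \o a) \+ (h \o t) : {linear P -> R^o}) => n.
by rewrite /= -aNP kP /= -linearD -nE.
Qed.

(** * Kernels in a complete resolution *)

Section Complex.
Variables (P : int -> lmodType R) (d : forall i : int, {linear P i -> P (i + 1)}).
Hypothesis PP : forall i, fin_generated (P i) /\ projective (P i).
Hypothesis ex : forall i (x : P (i + 1)), d (i + 1) x = 0 <-> exists y, x = d i y.
Hypothesis hex : forall i (f : {linear P (i + 1) -> R^o}),
  (forall x, f (d i x) = 0) <->
  exists g : {linear P (i + 1 + 1) -> R^o}, forall x, f x = g (d (i + 1) x).

Let Z i := submod (kern (d i)).

Lemma complex_syzygy i :
  exists p : {linear P i -> Z (i + 1)},
    (forall x, sub_val (p x) = d i x) /\ syzygy (@sub_val _ _ (kern (d i))) p.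
Proof.
have [p pE] : exists p : {linear P i -> Z (i + 1)}, forall x, sub_val (p x) = d i x.
  by apply: corestrict => x /=; apply/ex; exists x.
exists p; split=> //; split=> [|x||y]; [by case: (PP i)| |exact: sub_val_inj|].
  have /ex[y yE] := sub_valP x; exists y.
  by apply: sub_val_inj; rewrite pE.
rewrite -(sub_valE (kern (d i))) /= -pE; split=> [->|]; first exact: linear0.
by rewrite -[0 in X in X -> _](linear0 (@sub_val _ _ (kern (d (i + 1))))) => /sub_val_inj.
Qed.

(** Composed with the surjection from the preceding projective, a functional on the kernel is killed
    by the differential before it; exactness of the dual complex then extends it. The equation on
    [k] gives access to any integer degree although exactness is stated at successors. *)
Lemma complex_extends i k : k + 1 + 1 = i -> extends (@sub_val _ _ (kern (d i))).
Proof.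
move=> <- {i} f; have [p [pE [_ ps _ pk]]] := complex_syzygy (k + 1).
have /hex[g gE] : forall x, (f \o p : {linear P (k + 1) -> R^o}) (d k x) = 0.
  move=> x /=; rewrite (_ : p _ = 0) ?linear0 //; apply: sub_val_inj.
  by rewrite pE linear0; apply/ex; exists x.
by exists g => n; have [x <-] := ps n; rewrite pE -gE.
Qed.

Lemma complex_stable_summand (i j : int) X N (T : lmodType R)
    (n : {linear N -> T}) (p : {linear T -> X}) :
  i + 1 = j -> syzygy n p -> stable_summand X (Z j) ->
  stable_summand N (Z i) /\ extends n.
Proof.
move=> <- np XZ; have [q [_ qS]] := complex_syzygy i.
have [? eE] := stable_summand_syzygy np qS XZ; split=> //; apply: eE.
by apply: (@complex_extends i (i - 1 - 1)); rewrite !subrK.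
Qed.

End Complex.

(* The family [D i] stands for the successive syzygies of a complete resolution. *)
Lemma Gproj_syzygies G : Gproj G -> exists D : nat -> lmodType R,
  stable_summand G (D 0%N) /\
  forall k (X N T : lmodType R) (n : {linear N -> T}) (p : {linear T -> X}),
    syzygy n p -> stable_summand X (D k) -> stable_summand N (D k.+1) /\ extends n.
Proof.
case=> _ [P [d [PP ex hex [e eI ek]]]].
exists (fun k => submod (kern (d (- k%:Z)))); split; last first.
  move=> k X N T n p; apply: complex_stable_summand => //.
  by rewrite -addn1 PoszD opprD subrK.
rewrite oppr0.
have [f fE] : exists f : {linear G -> submod (kern (d 0))}, forall x, sub_val (f x) = e x.
  by apply: corestrict => x; apply/ek; exists x.
have [g gE] : exists g : {linear submod (kern (d 0)) -> G}, forall x, e (g x) = sub_val x.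
  by apply: factor_inj => // x; have /ek := sub_valP x.
(* Here [g] inverts [f], so the correction through a projective is zero. *)
exists f, g, (P 0), \0, e; split; first by case: (PP 0).
by move=> x; rewrite addr0; apply: eI; rewrite gE fE.
Qed.

End Syzygies.

(** * Path bases of monomial bound quiver algebras *)

Lemma gen_ideal_base (K : fieldType) (A : kalgType K) (S : A -> Prop) x :
  S x -> gen_ideal S x.
Proof. by move=> Sx; rewrite /gen_ideal /= => J; apply. Qed.

Section PathBasis.
Variables (K : fieldType) (Q : quiver) (I : rel (arrow Q)).
Implicit Types (v w : vertex Q) (s t : seq (arrow Q)) (a b : arrow Q).

Lemma kalg_inMl (B : kalgType K) (k : K) (x y : B) :
  x * (kalg_in k * y) = kalg_in k * (x * y).
Proof. by rewrite mulrA -kalg_inC -mulrA. Qed.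

Definition path_end v s := last v (map (@src Q) s).

(** The value 0 at lists that are not paths avoids carrying path proofs through concatenations. *)
Definition raw_elt v s : path_alg K Q :=
  if insub (v, s) : option (qpath Q) is Some p then path_elt K p else 0.

Lemma raw_eltE (p : qpath Q) : path_elt K p = raw_elt (path_tgt p) (path_arrows p).
Proof.
rewrite /raw_elt; case: insubP => [q _ qE|nP]; last by case/negP: nP; exact: (valP p).
suff -> : q = p by [].
by apply: val_inj; rewrite [LHS]qE [RHS]surjective_pairing.
Qed.

Lemma raw_elt0 v s : ~~ is_path v s -> raw_elt v s = 0.
Proof. by move=> sP; rewrite /raw_elt insubN. Qed.

Lemma is_path_end v s t : is_path v (s ++ t) = is_path v s && is_path (path_end v s) t.
Proof. exact: is_path_cat. Qed.

Lemma raw_eltM v s w t :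
  raw_elt v s * raw_elt w t = if path_end v s == w then raw_elt v (s ++ t) else 0.
Proof.
have [sP|sP] := boolP (is_path v s); last first.
  by rewrite (raw_elt0 sP) mul0r raw_elt0 ?if_same // is_path_end (negPf sP).
have [tP|tP] := boolP (is_path w t); last first.
  rewrite (raw_elt0 tP) mulr0; case: eqP => // <- in tP *.
  by rewrite raw_elt0 // is_path_end (negPf tP) andbF.
have E u r (h : is_path u r) : raw_elt u r = path_elt K (exist _ (u, r) h).
  exact/esym/raw_eltE.
rewrite (E _ _ sP) (E _ _ tP) path_eltM /mul_paths.
pose p : qpath Q := exist _ (v, s) sP; pose q : qpath Q := exist _ (w, t) tP.
have := path_mulP p q; rewrite -/p -/q.
have -> : path_src p = path_end v s by [].
have -> : path_tgt q = w by [].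
case: ifP => [_ [r -> [r1 r2 r3]]|_ -> //].
by rewrite raw_eltE r1 r3.
Qed.

Definition relation_free s := sorted (fun b a => ~~ I b a) s.
Definition nonzero_path v s := is_path v s && relation_free s.

Definition path_coef v s (x : path_alg K Q) : K :=
  if insub (v, s) : option (qpath Q) is Some p then mcoeff p x else 0.

Lemma path_coefD v s x y : path_coef v s (x + y) = path_coef v s x + path_coef v s y.
Proof. by rewrite /path_coef; case: insub => [p|]; rewrite ?addr0 ?mcoeffD. Qed.

Lemma path_coefZ v s k x : path_coef v s (kalg_in k * x) = k * path_coef v s x.
Proof.
rewrite /path_coef; case: insub => [p|]; rewrite ?mulr0 //.
by rewrite [kalg_in k * x]palg_inM palg_scaleE; exact: mcoeffZ.
Qed.

Lemma path_coef_raw v s w t :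
  path_coef v s (raw_elt w t) = ((v, s) == (w, t) :> _ * _)%:R *+ is_path v s.
Proof.
rewrite /path_coef; case: insubP => [p /= pP pE|/= sP]; last first.
  by rewrite (negPf sP).
rewrite pP /raw_elt; case: insubP => [q qP qE|tP].
  rewrite path_eltE mcoeffU -pE -qE eq_sym.
  by rewrite (inj_eq val_inj).
by rewrite mcoeff0; case: eqP => // -[vw st]; rewrite -vw -st pP in tP.
Qed.

Lemma path_alg_ind (P : path_alg K Q -> Prop) :
  P 0 -> (forall x y, P x -> P y -> P (x + y)) ->
  (forall k x, P x -> P (kalg_in k * x)) ->
  (forall v s, is_path v s -> P (raw_elt v s)) -> forall x, P x.
Proof.
move=> P0 PD PZ Pp; apply: palg_ind => // [k x Px|p].
  by rewrite -palg_inM; exact: PZ.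
by rewrite raw_eltE; apply: Pp; exact: (valP p).
Qed.

(** In contrast to [path_alg_ind], only the paths that occur in [x] have to be treated, so vanishing
    coordinates of [x] can be exploited. *)
Lemma path_span (P : path_alg K Q -> Prop) (x : path_alg K Q) :
  P 0 -> (forall x y, P x -> P y -> P (x + y)) ->
  (forall k x, P x -> P (kalg_in k * x)) ->
  (forall v s, is_path v s -> path_coef v s x != 0 -> P (raw_elt v s)) -> P x.
Proof.
move=> P0 PD PZ Pp; rewrite [x]palgE big_seq.
elim/big_ind: _ => // p; rewrite -mcoeff_neq0 => px.
rewrite -palg_inM raw_eltE; apply/PZ/Pp; first exact: (valP p).
rewrite /path_coef; case: insubP => [q _ qE|nP]; last by case/negP: nP; exact: (valP p).
suff -> : q = p by [].
by apply: val_inj; rewrite [LHS]qE [RHS]surjective_pairing.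
Qed.

(** The candidate for the relation ideal. A path containing a relation still contains it, or becomes
    zero, after multiplication by a path; this gives stability on both sides. *)
Let relation_ideal_pred (x : path_alg K Q) :=
  forall v s, nonzero_path v s -> path_coef v s x = 0.

Hypothesis Icomp : forall b a, I b a -> tgt a = src b.

Lemma arrow_eltE a : arrow_elt K a = raw_elt (tgt a) [:: a].
Proof. exact: raw_eltE. Qed.

Lemma relation_free_cat s t : relation_free (s ++ t) -> relation_free s /\ relation_free t.
Proof. by move=> /cat_sorted2[]. Qed.

Let free0 : relation_ideal_pred 0.
Proof.
by move=> v s _; rewrite /path_coef; case: insub => // p; exact: mcoeff0.
Qed.
Let freeD x y : relation_ideal_pred x -> relation_ideal_pred y -> relation_ideal_pred (x + y).
Proof. by move=> hx hy v s vs; rewrite path_coefD hx ?hy ?addr0. Qed.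
Let freeZ k x : relation_ideal_pred x -> relation_ideal_pred (kalg_in k * x).
Proof. by move=> hx v s vs; rewrite path_coefZ hx ?mulr0. Qed.

Let free_raw v s : ~~ relation_free s -> relation_ideal_pred (raw_elt v s).
Proof.
move=> sF w t /andP[_ tF]; rewrite path_coef_raw; case: eqP => [[_ ts]|]; last by rewrite mul0rn.
by rewrite ts (negPf sF) in tF.
Qed.

Let freeMl c x : relation_ideal_pred x -> relation_ideal_pred (c * x).
Proof.
move=> hx; elim/path_alg_ind: c => [|y z hy hz|k y hy|v s _].
- by rewrite mul0r; exact: free0.
- by rewrite mulrDl; exact: freeD.
- by rewrite -mulrA; exact: freeZ.
apply: (@path_span (fun x => relation_ideal_pred (_ * x))) => [|y z hy hz|k y hy|w t wtP xt].
- by rewrite mulr0; exact: free0.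
- by rewrite mulrDr; exact: freeD.
- by rewrite kalg_inMl; exact: freeZ.
rewrite raw_eltM; case: eqP => [_|_]; last exact: free0.
apply: free_raw; apply: contra xt => /relation_free_cat[_ tF].
by apply/eqP/hx; rewrite /nonzero_path wtP.
Qed.

Let freeMr x c : relation_ideal_pred x -> relation_ideal_pred (x * c).
Proof.
move=> hx; elim/path_alg_ind: c => [|y z hy hz|k y hy|v s _].
- by rewrite mulr0; exact: free0.
- by rewrite mulrDr; exact: freeD.
- by rewrite kalg_inMl; exact: freeZ.
apply: (@path_span (fun x => relation_ideal_pred (x * _))) => [|y z hy hz|k y hy|w t wtP xt].
- by rewrite mul0r; exact: free0.
- by rewrite mulrDl; exact: freeD.
- by rewrite -mulrA; exact: freeZ.
rewrite raw_eltM; case: eqP => [_|_]; last exact: free0.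
apply: free_raw; apply: contra xt => /relation_free_cat[tF _].
by apply/eqP/hx; rewrite /nonzero_path wtP.
Qed.

Lemma relation_ideal_raw v s : ~~ relation_free s -> relation_ideal K I (raw_elt v s).
Proof.
have [vs|vs _] := boolP (is_path v s); last first.
  by rewrite raw_elt0 //; exact: ideal0.
elim: s => [|b [|a s] IHs] //= in v vs *.
case/andP: vs => /eqP bv /andP[/eqP ab sP].
have -> : raw_elt v [:: b, a & s] = arrow_elt K b * raw_elt (src b) (a :: s).
  by rewrite arrow_eltE raw_eltM /path_end /= eqxx bv.
rewrite negb_and negbK => /orP[Iba|sF]; last first.
  by apply: (@idealMl _ _ (relation_ideal K I)); apply: IHs => //=; rewrite ab eqxx.
have -> : raw_elt (src b) (a :: s) = arrow_elt K a * raw_elt (src a) s.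
  by rewrite arrow_eltE raw_eltM /path_end /= eqxx ab.
rewrite mulrA; apply: (@idealMr _ _ (relation_ideal K I)).
by move=> J; apply; exists b, a.
Qed.

(** Elements without relation-free coordinates form an ideal containing the relations, and each is a
    combination of paths lying in the relation ideal. So the classes of relation-free paths are a
    basis of the quotient. *)
Lemma relation_idealP x :
  relation_ideal K I x <-> forall v s, nonzero_path v s -> path_coef v s x = 0.
Proof.
split=> [xI|x0]; last first.
  apply: path_span; [exact: ideal0|exact: idealD|by move=> k y; exact: idealMl|].
  move=> v s vs xs; apply: relation_ideal_raw; apply: contra xs => sF.
  by apply/eqP/x0; rewrite /nonzero_path vs.
apply: (xI (Ideal free0 freeD freeMl freeMr)) => _ [b [a [Iba ->]]] /= v s.
rewrite !arrow_eltE raw_eltM /path_end /= -(Icomp Iba) eqxx => vs.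
have h : ~~ relation_free [:: b; a] by rewrite /= Iba.
exact: free_raw h _ _ vs.
Qed.

End PathBasis.

(** * Algebra maps out of a bound quiver algebra *)

Section UniversalProperty.
Variables (K : fieldType) (Q : quiver) (B : kalgType K).
Variables (eps : vertex Q -> B) (xi : arrow Q -> B).
Hypothesis epsM : forall v w, eps v * eps w = if v == w then eps v else 0.
Hypothesis eps1 : \sum_v eps v = 1.
Hypothesis eps_xi : forall a, eps (tgt a) * xi a = xi a.
Hypothesis xi_eps : forall a, xi a * eps (src a) = xi a.
Implicit Types (v w : vertex Q) (s t : seq (arrow Q)) (a : arrow Q) (x y : path_alg K Q).

Definition path_val v s : B := eps v * \prod_(a <- s) xi a.

Lemma path_val_cons a s : path_val (tgt a) (a :: s) = xi a * path_val (src a) s.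
Proof. by rewrite /path_val big_cons !mulrA eps_xi xi_eps. Qed.

Lemma eps_path_val v s : eps v * path_val v s = path_val v s.
Proof. by rewrite /path_val mulrA epsM eqxx. Qed.

Lemma path_valM v s w t : is_path v s -> path_val v s * path_val w t =
  if path_end v s == w then path_val v (s ++ t) else 0.
Proof.
elim: s v => [|a s IHs] v /=.
  rewrite /path_val /path_end big_nil mulr1 mulrA epsM /=.
  by case: eqP => [->|_]; rewrite ?mul0r.
case/andP=> /eqP<- sP; rewrite !path_val_cons -mulrA IHs //.
by rewrite [path_end (tgt a) _]/(path_end (src a) s); case: ifP; rewrite ?mulr0.
Qed.

Definition path_lift x : B :=
  \sum_(p <- msupp x) kalg_in (mcoeff p x) * path_val (path_tgt p) (path_arrows p).

Let liftE (d : {fset qpath Q}) x : (msupp x `<=` d)%fset -> path_lift x =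
  \sum_(p <- d) kalg_in (mcoeff p x) * path_val (path_tgt p) (path_arrows p).
Proof.
move=> sx; rewrite /path_lift (big_fset_incl _ sx) // => p _ /mcoeff_outdom ->.
by rewrite rmorph0 mul0r.
Qed.

Lemma path_liftD x y : path_lift (x + y) = path_lift x + path_lift y.
Proof.
pose d := (msupp x `|` msupp y)%fset.
rewrite (liftE (d := d)) ?msuppD_le // (liftE (d := d) (x := x)) ?fsubsetUl //.
rewrite (liftE (d := d) (x := y)) ?fsubsetUr // -big_split; apply: eq_bigr => p _.
by rewrite mcoeffD rmorphD mulrDl.
Qed.

Lemma path_lift0 : path_lift 0 = 0.
Proof. by apply: (@addrI _ (path_lift 0)); rewrite -path_liftD !addr0. Qed.

Lemma path_liftZ k x : path_lift (kalg_in k * x) = kalg_in k * path_lift x.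
Proof.
rewrite [kalg_in k * x]palg_inM palg_scaleE.
rewrite (liftE (d := msupp x)) ?msuppZ_le // /path_lift mulr_sumr.
by apply: eq_bigr => p _; rewrite mcoeffZ rmorphM mulrA.
Qed.

Lemma path_lift_raw v s : is_path v s -> path_lift (raw_elt K v s) = path_val v s.
Proof.
move=> vs; rewrite -[raw_elt K v s](raw_eltE K (exist _ (v, s) vs)).
set p : qpath Q := exist _ _ _.
rewrite (liftE (d := [fset p]%fset)) ?path_eltE ?msuppU_le // (big_seq_fset1 _ p).
by rewrite mcoeffUU rmorph1 mul1r.
Qed.

Let lift_zmod : zmod_morphism path_lift.
Proof.
move=> x y; have liftN z : path_lift (- z) = - path_lift z.
  have -> : - z = kalg_in (- 1) * z by rewrite rmorphN rmorph1 mulN1r.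
  by rewrite path_liftZ rmorphN rmorph1 mulN1r.
by rewrite path_liftD liftN.
Qed.

Let lift_monoid : monoid_morphism path_lift.
Proof.
split=> [|x y].
  have -> : 1 = \sum_v raw_elt K v [::] :> path_alg K Q.
    by rewrite [LHS]/(palg_one K Q); apply: eq_bigr => v _; rewrite raw_eltE.
  rewrite (big_morph path_lift path_liftD path_lift0) -eps1; apply: eq_bigr => v _.
  by rewrite path_lift_raw // /path_val big_nil mulr1.
elim/path_alg_ind: x => [|x x' IH IH'|k x IH|v s sP].
- by rewrite !(mul0r, path_lift0).
- by rewrite mulrDl !path_liftD IH IH' mulrDl.
- by rewrite -mulrA !path_liftZ IH mulrA.
elim/path_alg_ind: y => [|y y' IH IH'|k y IH|w t tP].
- by rewrite !(mulr0, path_lift0).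
- by rewrite mulrDr !path_liftD IH IH' mulrDr.
- by rewrite kalg_inMl !path_liftZ IH kalg_inMl.
rewrite raw_eltM !path_lift_raw // path_valM //; case: eqP => [sw|_]; last exact: path_lift0.
by rewrite path_lift_raw // is_path_end sP sw.
Qed.

Definition path_lift_morph : {rmorphism path_alg K Q -> B} :=
  HB.pack path_lift (GRing.isZmodMorphism.Build (path_alg K Q) B path_lift lift_zmod)
    (GRing.isMonoidMorphism.Build (path_alg K Q) B path_lift lift_monoid).

Lemma path_lift_morph_in k : path_lift_morph (kalg_in k) = kalg_in k.
Proof.
rewrite -[kalg_in k in LHS]mulr1 [LHS]path_liftZ.
by rewrite (rmorph1 path_lift_morph : path_lift 1 = 1) mulr1.
Qed.

End UniversalProperty.

(** * The first isomorphism theorem for algebras *)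

Section QuotientIsomorphism.
Variables (K : fieldType) (A B : kalgType K).

Lemma kalg_iso_sym : kalg_iso A B -> kalg_iso B A.
Proof.
move=> [f [fK [g fg gf]]].
have gz : zmod_morphism g by move=> x y; apply: (can_inj fg); rewrite rmorphB !gf.
have gm : monoid_morphism g.
  by split=> [|x y]; apply: (can_inj fg); rewrite ?rmorph1 ?rmorphM !gf.
pose g' : {rmorphism B -> A} := HB.pack g (GRing.isZmodMorphism.Build B A g gz)
  (GRing.isMonoidMorphism.Build B A g gm).
exists g'; split; last by exists f.
by move=> k; rewrite -fK; exact: fg.
Qed.

Variables (J : ideal A) (f : {rmorphism A -> B}).
Hypothesis fK : forall k, f (kalg_in k) = kalg_in k.
Hypothesis f_ker : forall x, f x = 0 <-> J x.
Hypothesis f_surj : forall y, exists x, f x = y.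

Lemma quot_kalg_iso : kalg_iso (quot_alg J) B.
Proof.
pose g (u : quot_alg J) : B := f (qrepr u).
have gpi x : g (qpi J x) = f x.
  by apply/subr0_eq; rewrite -rmorphB; apply/f_ker; exact: qpi_repr.
have ex (u : quot_alg J) : exists x, u = qpi J x by exists (qrepr u); rewrite qreprK.
have gz : zmod_morphism g.
  move=> u v; have [x ->] := ex u; have [y ->] := ex v.
  by rewrite -raddfB !gpi rmorphB.
have gm : monoid_morphism g.
  split=> [|u v]; first by rewrite [LHS](gpi 1) rmorph1.
  have [x ->] := ex u; have [y ->] := ex v.
  by rewrite -rmorphM !gpi rmorphM.
pose g' : {rmorphism quot_alg J -> B} :=
  HB.pack g (GRing.isZmodMorphism.Build (quot_alg J) B g gz)
    (GRing.isMonoidMorphism.Build (quot_alg J) B g gm).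
have /boolp.choice[h hE] := f_surj.
exists g'; split=> [k|]; first by rewrite [LHS](gpi (kalg_in k)) fK.
exists (fun y => qpi J (h y)) => [u|y]; last by rewrite [LHS]gpi hE.
have [x ->] := ex u; apply/qpiP/f_ker.
by rewrite rmorphB hE [g' _]gpi subrr.
Qed.
End QuotientIsomorphism.

(** * Gentle algebras *)

Section GentleAlgebra.
Variables (K : fieldType) (Q : quiver) (I : rel (arrow Q)).
Notation A := (bound_quiver_alg K I).
Implicit Types (v w : vertex Q) (s t : seq (arrow Q)) (a b : arrow Q).
Hypothesis Icomp : forall b a, I b a -> tgt a = src b.

Definition path_cls v s : A := qpi (relation_ideal K I) (raw_elt K v s).

(** Setting the coordinate to 0 at lists containing a relation makes it independent of the
    representative [qrepr x]. *)
Definition cls_coef v s (x : A) : K :=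
  if relation_free I s then path_coef v s (qrepr x) else 0.

Lemma cls_coef_qpi v s x :
  cls_coef v s (qpi (relation_ideal K I) x) = if relation_free I s then path_coef v s x else 0.
Proof.
rewrite /cls_coef; case: ifP => // sF.
have [vs|vs] := boolP (is_path v s); last by rewrite /path_coef insubN.
have /(relation_idealP Icomp)/(_ v s) := qpi_repr (relation_ideal K I) x.
rewrite /nonzero_path vs sF => /(_ isT) h.
by rewrite -[qrepr _](subrK x) path_coefD h add0r.
Qed.

Lemma bound_ind (P : A -> Prop) :
  (forall x, P (qpi (relation_ideal K I) x)) -> forall x, P x.
Proof. by move=> PP x; rewrite -[x]qreprK. Qed.

Let qpiD (x y : path_alg K Q) :
  qpi (relation_ideal K I) (x + y) = qpi (relation_ideal K I) x + qpi (relation_ideal K I) y :> A.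
Proof. exact: raddfD. Qed.
Let qpiM (x y : path_alg K Q) :
  qpi (relation_ideal K I) (x * y) = qpi (relation_ideal K I) x * qpi (relation_ideal K I) y :> A.
Proof. exact: (rmorphM (qpi (relation_ideal K I))). Qed.
Let qpi_in k : qpi (relation_ideal K I) (kalg_in k) = kalg_in k :> A.
Proof. by []. Qed.

Lemma cls_coefD v s x y : cls_coef v s (x + y) = cls_coef v s x + cls_coef v s y.
Proof.
elim/bound_ind: x => x; elim/bound_ind: y => y.
by rewrite -qpiD !cls_coef_qpi; case: ifP; rewrite ?addr0 ?path_coefD.
Qed.

Lemma cls_coefZ v s k x : cls_coef v s (kalg_in k * x) = k * cls_coef v s x.
Proof.
elim/bound_ind: x => x; rewrite -qpi_in -qpiM !cls_coef_qpi.
by case: ifP; rewrite ?mulr0 ?path_coefZ.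
Qed.

Lemma cls_coef0 v s : cls_coef v s 0 = 0.
Proof. by apply: (@addrI _ (cls_coef v s 0)); rewrite -cls_coefD !addr0. Qed.

Lemma cls_coefN v s x : cls_coef v s (- x) = - cls_coef v s x.
Proof. by apply: (@addrI _ (cls_coef v s x)); rewrite -cls_coefD !subrr cls_coef0. Qed.

Lemma cls_coefB v s x y : cls_coef v s (x - y) = cls_coef v s x - cls_coef v s y.
Proof. by rewrite cls_coefD cls_coefN. Qed.

Lemma cls_coef_sum v s (J : Type) (r : seq J) (P : pred J) (F : J -> A) :
  cls_coef v s (\sum_(i <- r | P i) F i) = \sum_(i <- r | P i) cls_coef v s (F i).
Proof. by apply: (big_morph (cls_coef v s)) => [x y|]; [exact: cls_coefD|exact: cls_coef0]. Qed.

Lemma path_cls0 v s : ~~ nonzero_path I v s -> path_cls v s = 0.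
Proof.
have q0 : qpi (relation_ideal K I) 0 = 0 by exact: raddf0.
rewrite negb_and => /orP[vs|sF]; first by rewrite /path_cls raw_elt0.
rewrite -q0; apply/qpiP; rewrite subr0; exact: relation_ideal_raw.
Qed.

Lemma cls_coef_cls v s w t :
  cls_coef v s (path_cls w t) = ((v, s) == (w, t) :> _ * _)%:R *+ nonzero_path I v s.
Proof.
by rewrite cls_coef_qpi path_coef_raw /nonzero_path; case: (relation_free I s);
  rewrite ?andbT ?andbF.
Qed.

Lemma path_clsM v s w t :
  path_cls v s * path_cls w t = if path_end v s == w then path_cls v (s ++ t) else 0.
Proof.
rewrite -qpiM raw_eltM; case: eqP => // _; exact: raddf0.
Qed.

Lemma bound_span (P : A -> Prop) (x : A) :
  P 0 -> (forall x y, P x -> P y -> P (x + y)) ->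
  (forall k x, P x -> P (kalg_in k * x)) ->
  (forall v s, nonzero_path I v s -> cls_coef v s x != 0 -> P (path_cls v s)) -> P x.
Proof.
move=> P0 PD PZ Pp; rewrite -[x]qreprK.
apply: (path_span (P := fun y => P (qpi _ y))) => [|y z|k y|v s vs xs].
- by have -> : qpi (relation_ideal K I) 0 = 0 by exact: raddf0.
- by rewrite qpiD; exact: PD.
- by rewrite qpiM; exact: PZ.
have [sF|sF] := boolP (nonzero_path I v s); last first.
  by rewrite -/(path_cls v s) path_cls0.
apply: Pp => //; rewrite /cls_coef; by case/andP: sF => _ ->.
Qed.

Lemma bound_path_ind (P : A -> Prop) :
  P 0 -> (forall x y, P x -> P y -> P (x + y)) ->
  (forall k x, P x -> P (kalg_in k * x)) ->
  (forall v s, nonzero_path I v s -> P (path_cls v s)) -> forall x, P x.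
Proof. by move=> P0 PD PZ Pp x; apply: bound_span => // v s vs _; exact: Pp. Qed.

Lemma cls_coef_eq0 x : (forall v s, nonzero_path I v s -> cls_coef v s x = 0) -> x = 0.
Proof.
move=> x0; apply: (bound_span (P := fun x => x = 0)) => [//|y z -> ->|k y ->|v s vs];
  first exact: addr0.
  exact: mulr0.
by rewrite x0 // eqxx.
Qed.

Definition idem v : A := path_cls v [::].
Definition arr a : A := path_cls (tgt a) [:: a].

Lemma sum_idem : \sum_v idem v = 1.
Proof.
have -> : 1 = qpi (relation_ideal K I) 1 :> A by [].
rewrite [1 in RHS](_ : _ = \sum_v path_elt K (vertex_path v)) // raddf_sum.
by apply: eq_bigr => v _; rewrite raw_eltE.
Qed.

Lemma cls_coef_idemM w t v y :
  cls_coef w t (idem v * y) = if w == v then cls_coef w t y else 0.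
Proof.
elim/bound_path_ind: y => [|x y hx hy|k x hx|u s _].
- by rewrite mulr0 !cls_coef0 if_same.
- by rewrite mulrDr !cls_coefD hx hy; case: ifP; rewrite ?addr0.
- by rewrite kalg_inMl !cls_coefZ hx; case: ifP; rewrite ?mulr0.
rewrite path_clsM /path_end /=; case: (eqVneq v u) => [<-|vu].
  by rewrite !cls_coef_cls xpair_eqE; case: eqP => // wv; rewrite mul0rn.
rewrite cls_coef0 cls_coef_cls xpair_eqE; case: (eqVneq w v) => // ->.
by rewrite (negPf vu) mul0rn.
Qed.

Lemma cls_coef_Midem w t v y :
  cls_coef w t (y * idem v) = if path_end w t == v then cls_coef w t y else 0.
Proof.
elim/bound_path_ind: y => [|x y hx hy|k x hx|u s _].
- by rewrite mul0r !cls_coef0 if_same.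
- by rewrite mulrDl !cls_coefD hx hy; case: ifP; rewrite ?addr0.
- by rewrite -mulrA !cls_coefZ hx; case: ifP; rewrite ?mulr0.
rewrite path_clsM cats0; case: (eqVneq (path_end u s) v) => [uv|uv].
  rewrite !cls_coef_cls; case: ((w, t) =P (u, s)) => [[-> ->]|]; first by rewrite uv eqxx.
  by rewrite mul0rn if_same.
rewrite cls_coef0 cls_coef_cls; case: ((w, t) =P (u, s)) => [[-> ->]|_];
  last by rewrite mul0rn if_same.
by rewrite (negPf uv).
Qed.

(** Left multiplication by [b] puts [b] in front of each path, so a coordinate of the product is at
    most one coordinate of [y]; the condition [nonzero_path] discards the paths in which [b]
    completes a relation. *)
Lemma cls_coef_arrM w t b y :
  cls_coef w t (arr b * y) = if t is a :: t' then
    (cls_coef (src b) t' y *+ [&& a == b, w == tgt b & nonzero_path I w t]) else 0.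
Proof.
elim/bound_path_ind: y => [|x y hx hy|k x hx|u s _].
- by rewrite mulr0 cls_coef0; case: t => // a t; rewrite cls_coef0 mul0rn.
- by rewrite mulrDr cls_coefD hx hy; case: (t) => [|a t']; rewrite ?addr0 // cls_coefD mulrnDl.
- by rewrite kalg_inMl cls_coefZ hx; case: (t) => [|a t']; rewrite ?mulr0 // cls_coefZ mulrnAr.
rewrite path_clsM [path_end _ _]/= /path_end /=.
case: t => [|a t].
  by case: ifP => _; rewrite ?cls_coef0 // cls_coef_cls xpair_eqE /= andbF; exact: mul0rn.
case: (eqVneq (src b) u) => [<-|bu]; last first.
  by rewrite cls_coef0 cls_coef_cls xpair_eqE (negPf bu) !mul0rn.
rewrite !cls_coef_cls !xpair_eqE eqxx /= eqseq_cons.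
case: (eqVneq w (tgt b)) => [->|]; last by rewrite /= ?andbF !(mulr0n, mul0rn).
case: (eqVneq a b) => [->|]; last by rewrite /= !(mulr0n, mul0rn).
case: eqP => [->|_]; last by rewrite !mul0rn.
rewrite /nonzero_path /= eqxx /=.
case: (boolP (is_path _ _)) => //= sP; case: (boolP (path _ _ _)) => //= /path_sorted sF.
by rewrite /relation_free sF.
Qed.

Lemma cls_coef_arrM_cons b t y :
  cls_coef (tgt b) (b :: t) (arr b * y) = cls_coef (src b) t y *+ nonzero_path I (tgt b) (b :: t).
Proof. by rewrite cls_coef_arrM !eqxx. Qed.

Lemma cls_coef_Marr w t b y :
  cls_coef w t (y * arr b) = if t is a :: t' then
    cls_coef w (belast a t') y *+ [&& last a t' == b, path_end w (belast a t') == tgt b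
       & nonzero_path I w t] else 0.
Proof.
elim/bound_path_ind: y => [|x y hx hy|k x hx|u s _].
- by rewrite mul0r cls_coef0; case: t => // a t; rewrite cls_coef0 mul0rn.
- by rewrite mulrDl cls_coefD hx hy; case: (t) => [|a t']; rewrite ?addr0 // cls_coefD mulrnDl.
- by rewrite -mulrA cls_coefZ hx; case: (t) => [|a t']; rewrite ?mulr0 // cls_coefZ mulrnAr.
rewrite path_clsM cats1.
case/lastP: t => [|t a].
  by case: ifP => _; rewrite ?cls_coef0 // cls_coef_cls xpair_eqE; case: (s) => [|c l] /=;
    rewrite andbF mul0rn.
(* The first arrow of [rcons t a] is [head a t], the default [a] being the right value for empty
   [t]; this removes the match. *)
have -> (F : arrow Q -> seq (arrow Q) -> K) d :
    (if rcons t a is c :: t' then F c t' else d) = F (head a t) (behead (rcons t a)).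
  by case: (t).
have -> : belast (head a t) (behead (rcons t a)) = t.
  by case: (t) => //= c l; rewrite belast_rcons.
have -> : last (head a t) (behead (rcons t a)) = a.
  by case: (t) => //= c l; rewrite last_rcons.
case: (eqVneq (path_end u s) (tgt b)) => [ub|ub]; last first.
  rewrite cls_coef0 cls_coef_cls; case: ((w, t) =P (u, s)) => [[-> ->]|]; last by rewrite !mul0rn.
  by rewrite (negPf ub) andbF.
rewrite !cls_coef_cls !xpair_eqE eqseq_rcons.
case: (eqVneq w u) => [->|]; last by rewrite /= !(mulr0n, mul0rn).
case: (eqVneq a b) => [->|]; last by rewrite /= andbF !(mulr0n, mul0rn).
rewrite andbT; case: (eqVneq t s) => [->|]; last by rewrite /= !(mulr0n, mul0rn).
rewrite ub eqxx /= /nonzero_path -!cats1 is_path_end ub /= eqxx /= andbT.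
case: (boolP (is_path _ _)) => //= sP; case: (boolP (relation_free _ _)) => //=.
by move=> /relation_free_cat[-> _].
Qed.

Lemma cls_coef_Marr_rcons w t b y :
  cls_coef w (rcons t b) (y * arr b) = cls_coef w t y *+ nonzero_path I w (rcons t b).
Proof.
have E : nonzero_path I w (rcons t b) = (path_end w t == tgt b) && nonzero_path I w (rcons t b).
  rewrite /nonzero_path -cats1 is_path_end /= andbT (eq_sym (tgt b)).
  by case: eqP; rewrite ?andbF.
rewrite cls_coef_Marr [in RHS]E; case: (t) => [|c l] /=; first by rewrite !eqxx.
by rewrite last_rcons belast_rcons eqxx.
Qed.

Lemma idemM v w : idem v * idem w = if v == w then idem v else 0.
Proof. by rewrite path_clsM. Qed.
Lemma idem_arr v a : idem v * arr a = if v == tgt a then arr a else 0.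
Proof. by rewrite path_clsM /path_end /=; case: eqP => // ->. Qed.
Lemma arr_idem v a : arr a * idem v = if src a == v then arr a else 0.
Proof. by rewrite path_clsM. Qed.
Lemma arrM b a : tgt a = src b -> arr b * arr a = path_cls (tgt b) [:: b; a].
Proof. by rewrite path_clsM => ->; rewrite eqxx. Qed.
Lemma arrM0 b a : I b a -> arr b * arr a = 0.
Proof.
move=> Iba; rewrite arrM ?path_cls0 //; last exact: Icomp.
by rewrite /nonzero_path /= Iba !andbF.
Qed.

Lemma path_cls_cons b t : path_cls (tgt b) (b :: t) = arr b * path_cls (src b) t.
Proof. by rewrite path_clsM eqxx. Qed.
Lemma path_cls_rcons v t b : path_end v t = tgt b ->
  path_cls v (rcons t b) = path_cls v t * arr b.
Proof. by rewrite path_clsM => ->; rewrite eqxx cats1. Qed.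

(* The k-th power of the arrow ideal, read off coordinates. *)
Definition rad_pow k (x : A) := forall v s, (size s < k)%N -> cls_coef v s x = 0.

Lemma rad_pow_span k x (P : A -> Prop) : rad_pow k x ->
  P 0 -> (forall x y, P x -> P y -> P (x + y)) ->
  (forall k x, P x -> P (kalg_in k * x)) ->
  (forall v s, nonzero_path I v s -> (k <= size s)%N -> P (path_cls v s)) -> P x.
Proof.
move=> kx P0 PD PZ Pp; apply: bound_span => // v s vs.
by move=> xs; apply: Pp => //; rewrite leqNgt; apply: contra xs => /(kx v) ->.
Qed.

Lemma rad_pow0 k : rad_pow k 0. Proof. by move=> v s _; exact: cls_coef0. Qed.
Lemma rad_powD k x y : rad_pow k x -> rad_pow k y -> rad_pow k (x + y).
Proof. by move=> hx hy v s sk; rewrite cls_coefD hx ?hy ?addr0. Qed.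
Lemma rad_powZ k c x : rad_pow k x -> rad_pow k (kalg_in c * x).
Proof. by move=> hx v s sk; rewrite cls_coefZ hx ?mulr0. Qed.
Lemma rad_powN k x : rad_pow k x -> rad_pow k (- x).
Proof. by move=> hx v s sk; rewrite cls_coefN hx ?oppr0. Qed.
Lemma rad_pow_sum k (J : Type) (r : seq J) (P : pred J) (F : J -> A) :
  (forall j, P j -> rad_pow k (F j)) -> rad_pow k (\sum_(j <- r | P j) F j).
Proof. by move=> h; elim/big_ind: _ => //; [exact: rad_pow0|exact: rad_powD]. Qed.
Lemma rad_pow_cls v s : rad_pow (size s) (path_cls v s).
Proof.
move=> w t ts; rewrite cls_coef_cls; case: eqP => [[_ E]|]; last by rewrite mul0rn.
by rewrite E ltnn in ts.
Qed.
Lemma rad_pow_arr a : rad_pow 1 (arr a). Proof. exact: (@rad_pow_cls _ [:: a]). Qed.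

Lemma rad_powM i j x y : rad_pow i x -> rad_pow j y -> rad_pow (i + j) (x * y).
Proof.
move=> ix jy; apply: (rad_pow_span (P := fun x => rad_pow (i + j) (x * y)) ix).
- by rewrite mul0r; exact: rad_pow0.
- by move=> u v hu hv; rewrite mulrDl; exact: rad_powD.
- by move=> k u hu; rewrite -mulrA; exact: rad_powZ.
move=> v s _ si; apply: (rad_pow_span (P := fun y => rad_pow (i + j) (_ * y)) jy).
- by rewrite mulr0; exact: rad_pow0.
- by move=> u w hu hv; rewrite mulrDr; exact: rad_powD.
- by move=> k u hu; rewrite kalg_inMl; exact: rad_powZ.
move=> w t _ tj; rewrite path_clsM; case: ifP => _; last exact: rad_pow0.
move=> u r; move: (@rad_pow_cls v (s ++ t) u r) => h ur; apply: h.
by rewrite size_cat (leq_trans ur) // leq_add.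
Qed.

Lemma rad_powMr j x y : rad_pow j x -> rad_pow j (x * y).
Proof. by move=> jx; rewrite -[j]addn0; apply: rad_powM. Qed.

(** * Nilpotency of the radical and annihilators of arrows *)

Hypothesis Iadm : admissible (relation_ideal K I).

(** Admissibility puts every path of some length [m] into the relation ideal, and a longer path has
    an initial factor of length [m]. *)
Lemma rad_pow_nilp : exists m, forall x, rad_pow m x -> x = 0.
Proof.
case: Iadm => _ [m _ mI]; exists m => x mx.
apply: (rad_pow_span (P := fun x => x = 0) mx) => [//|y z -> ->|k y ->|v s vs ms];
  first exact: addr0.
  exact: mulr0.
suff : relation_ideal K I (raw_elt K v s).
  by move=> h; rewrite -(cls_coef_eq0 (x := path_cls v s)) // => w t wt;
     rewrite cls_coef_qpi; case: ifP => // _; apply: (proj1 (relation_idealP Icomp _) h).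
case/andP: vs => vs _; apply: mI; rewrite -(cat_take_drop m s) in vs *.
have -> : raw_elt K v (take m s ++ drop m s) =
    raw_elt K v (take m s) * raw_elt K (path_end v (take m s)) (drop m s).
  by rewrite raw_eltM eqxx.
suff h : arrow_ideal_pow K Q m (raw_elt K v (take m s)) by exact: (idealMr _ h).
move: vs; rewrite is_path_end => /andP[vs _]; apply: gen_ideal_base.
exists (exist _ (v, take m s) vs); split; last by rewrite raw_eltE.
by rewrite /path_length /path_arrows /= size_take_min; apply/minn_idPl.
Qed.

(** The geometric series in the nilpotent element [r] is finite. *)
Lemma rad_pow1_unit r : rad_pow 1 r -> exists u, u * (1 - r) = 1.
Proof.
move=> r1; have [m mP] := rad_pow_nilp.
have rm : r ^+ m = 0.
  apply: mP; elim: (m) => [|n IHn]; first by move=> v s; rewrite ltn0.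
  by rewrite exprS -[n.+1]add1n; apply: rad_powM.
exists (\sum_(i < m) r ^+ i).
have -> : (\sum_(i < m) r ^+ i) * (1 - r) = - ((r - 1) * \sum_(i < m) r ^+ i).
  rewrite -mulNr opprB mulr_suml mulr_sumr; apply: eq_bigr => i _.
  by rewrite mulrBr mulrBl mulr1 mul1r -exprSr -exprS.
by rewrite -subrX1 rm sub0r opprK.
Qed.

(** Let [s] be a path occurring in [y] and ending at [src c]. Unless [s] begins with an arrow [a]
    such that [I c a], the list [c :: s] is a nonzero path, and its coordinate in [arr c * y] is the
    nonzero one of [s] in [y]. *)
Lemma arrM_eq0 c y : arr c * y = 0 ->
  exists d : arrow Q -> A, idem (src c) * y = \sum_(a | I c a) arr a * d a.
Proof.
move=> cy; pose P z := exists d : arrow Q -> A, z = \sum_(a | I c a) arr a * d a.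
apply: (bound_span (P := P)).
- by exists (fun=> 0); rewrite big1 // => a _; exact: mulr0.
- move=> _ _ [d ->] [d' ->]; exists (fun a => d a + d' a).
  by rewrite -big_split; apply: eq_bigr => a _; rewrite mulrDr.
- move=> k _ [d ->]; exists (fun a => kalg_in k * d a).
  by rewrite mulr_sumr; apply: eq_bigr => a _; rewrite kalg_inMl.
move=> v s vs; rewrite cls_coef_idemM; case: (v =P src c) => [vc|]; last by rewrite eqxx.
have cs0 : nonzero_path I (tgt c) (c :: s) -> cls_coef v s y = 0.
  by move=> cs; have := cls_coef_arrM_cons c s y; rewrite cy cls_coef0 cs -vc.
have cP : is_path (tgt c) (c :: s) by rewrite /= eqxx -vc; case/andP: vs.
case: s vs cs0 cP => [|a s] vs cs0 cP; first by rewrite cs0 ?eqxx // /nonzero_path cP.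
have [Ica _|Ica] := boolP (I c a); last first.
  by rewrite cs0 ?eqxx // /nonzero_path cP /= Ica; case/andP: vs.
have /andP[/= /andP[/eqP av _] _] := vs.
exists (fun a' => if a' == a then path_cls (src a) s else 0).
rewrite (bigD1 a) //= eqxx -path_cls_cons av big1 ?addr0 // => a' /andP[_ /negPf->].
exact: mulr0.
Qed.

Lemma Marr_eq0 c y : y * arr c = 0 ->
  exists d : arrow Q -> A, y * idem (tgt c) = \sum_(b | I b c) d b * arr b.
Proof.
move=> cy; pose P z := exists d : arrow Q -> A, z = \sum_(b | I b c) d b * arr b.
apply: (bound_span (P := P)).
- by exists (fun=> 0); rewrite big1 // => a _; exact: mul0r.
- move=> _ _ [d ->] [d' ->]; exists (fun a => d a + d' a).
  by rewrite -big_split; apply: eq_bigr => a _; rewrite mulrDl.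
- move=> k _ [d ->]; exists (fun a => kalg_in k * d a).
  by rewrite mulr_sumr; apply: eq_bigr => a _; rewrite mulrA.
move=> v s vs; rewrite cls_coef_Midem; case: (path_end v s =P tgt c) => [vc|];
  last by rewrite eqxx.
have cs0 : nonzero_path I v (rcons s c) -> cls_coef v s y = 0.
  by move=> cs; have := cls_coef_Marr_rcons v s c y; rewrite cy cls_coef0 cs.
have cP : is_path v (rcons s c).
  by rewrite -cats1 is_path_end vc /= eqxx; case/andP: vs => ->.
case/lastP: s vs vc cs0 cP => [|s b] vs vc cs0 cP.
  by rewrite cs0 ?eqxx // /nonzero_path cP.
have [Ibc _|Ibc] := boolP (I b c); last first.
  rewrite cs0 ?eqxx // /nonzero_path cP /= /relation_free.
  have /andP[_] := vs; rewrite /relation_free.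
  case: (s) => [|a l] /=; first by rewrite Ibc.
  by rewrite [in X in _ -> X]rcons_path last_rcons Ibc andbT.
have /andP[] := vs; rewrite -cats1 is_path_end /= andbT => /andP[_ /eqP sb] _.
exists (fun b' => if b' == b then path_cls v s else 0).
rewrite (bigD1 b) //= eqxx -path_cls_rcons // cats1 big1 ?addr0 // => b' /andP[_ /negPf->].
exact: mul0r.
Qed.

(* Indices of the left ideals: [inl v] for [A e_v] and [inr a] for [A a]. *)
Definition gtype := (vertex Q + arrow Q)%type.
Implicit Types (x y : gtype).

Definition gen x : A := match x with inl v => idem v | inr a => arr a end.
Definition gtgt x : vertex Q := match x with inl v => v | inr a => tgt a end.
Definition glist x : seq (arrow Q) := match x with inl v => [::] | inr a => [:: a] end.

Lemma gen_cls x : gen x = path_cls (gtgt x) (glist x). Proof. by case: x. Qed.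

Lemma idem_gen x : idem (gtgt x) * gen x = gen x.
Proof. by rewrite gen_cls path_clsM /path_end /= eqxx. Qed.

Lemma cls_coef_gen x z : cls_coef (gtgt x) (glist x) (z * gen x) = cls_coef (gtgt x) [::] z.
Proof.
case: x => [v|a]; first by rewrite cls_coef_Midem /path_end /= eqxx.
by rewrite (cls_coef_Marr_rcons _ [::]) /= /nonzero_path /= eqxx mulr1n.
Qed.

Lemma idem_idem v : idem v * idem v = idem v.
Proof. by rewrite idemM eqxx. Qed.

Lemma cls_coef_idem v : cls_coef v [::] (idem v) = 1.
Proof. by rewrite cls_coef_cls eqxx. Qed.

Lemma gen_neq0 x : gen x <> 0.
Proof.
move=> g0; have := cls_coef_gen x (idem (gtgt x)).
by rewrite idem_gen g0 cls_coef0 cls_coef_idem => /eqP; rewrite eq_sym oner_eq0.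
Qed.

Section PrincipalLeftIdeal.
Variable g : A.
Definition princ_mem (p : A^o) := exists a : A, p = a * g.
Let princ0 : princ_mem 0. Proof. by exists 0; rewrite mul0r. Qed.
Let princD p q : princ_mem p -> princ_mem q -> princ_mem (p + q).
Proof. by move=> [a ->] [b ->]; exists (a + b); rewrite mulrDl. Qed.
Let princZ (a : A) p : princ_mem p -> princ_mem (a *: p).
Proof. by move=> [b ->]; exists (a * b); rewrite -mulrA. Qed.
Definition princ : submodule (A^o) := Submodule princ0 princD princZ.
End PrincipalLeftIdeal.

Definition gmod x : lmodType A := submod (princ (gen x)).
Definition fval x : {linear gmod x -> A^o} := @sub_val _ _ (princ (gen x)).

Lemma gen_princ x : princ (gen x) (gen x). Proof. by exists 1; rewrite mul1r. Qed.
Definition fgen x : gmod x := smk (gen_princ x).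
Lemma fval_gen x : fval x (fgen x) = gen x. Proof. by []. Qed.
Lemma fval_inj x : injective (fval x). Proof. exact: sub_val_inj. Qed.
Lemma fvalZ x (a : A) (u : gmod x) : fval x (a *: u) = a * fval x u.
Proof. exact: linearZ. Qed.

Lemma gmod_elt x (u : gmod x) : exists a : A, u = a *: fgen x.
Proof.
have [a aE] := sub_valP u; exists a; apply: fval_inj.
by rewrite fvalZ fval_gen -aE.
Qed.

Lemma idem_fgen x : idem (gtgt x) *: fgen x = fgen x.
Proof. by apply: fval_inj; rewrite fvalZ fval_gen idem_gen. Qed.

Lemma gmod_hom_eq x (M : lmodType A) (f h : {linear gmod x -> M}) :
  f (fgen x) = h (fgen x) -> f =1 h.
Proof. by move=> fh u; have [a ->] := gmod_elt u; rewrite !linearZ /= fh. Qed.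

(** The left ideal is cyclic, hence a quotient of [A] by the annihilator of its generator. *)
Lemma gmod_hom x (M : lmodType A) (m : M) :
  (forall a : A, a * gen x = 0 -> a *: m = 0) ->
  exists f : {linear gmod x -> M}, f (fgen x) = m.
Proof.
move=> ann; have /choice[c cP] := @gmod_elt x.
have well (a b : A) : a *: fgen x = b *: fgen x -> a *: m = b *: m.
  move=> ab; apply/subr0_eq; rewrite -scalerBl; apply: ann.
  by rewrite mulrBl -fval_gen -!fvalZ ab subrr.
have fL : linear (fun u : gmod x => c u *: m).
  move=> a u v; rewrite scalerA -scalerDl; apply: well.
  by rewrite -cP scalerDl -scalerA -!cP.
exists (lin_of fL); rewrite lin_ofE -[RHS]scale1r; apply: well.
by rewrite -cP scale1r.
Qed.

Lemma gmod_rmul x y (z : A) : princ (gen y) (gen x * z) ->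
  exists f : {linear gmod x -> gmod y}, forall u, fval y (f u) = fval x u * z.
Proof.
move=> [b bE].
have hL : linear (fun u : gmod x => (fval x u * z : A^o)).
  by move=> a u v; rewrite linearP mulrDl -[a *: fval x u]/(a * fval x u) -mulrA.
apply: (corestrict (h := lin_of hL)) => u; rewrite lin_ofE.
have [a ->] := gmod_elt u; exists (a * b).
by rewrite fvalZ fval_gen -!mulrA bE.
Qed.

(* When no [I b a] holds, [A a] is isomorphic to [A e_(tgt a)]; such indices are excluded. *)
Definition has_succ x := if x is inr a then exists b, I b a else True.

(** These equations present [gmod x]: the left annihilator of an arrow [a] is generated by
    [1 - e_(tgt a)] and the arrows [b] with [I b a]. *)
Definition valid (M : lmodType A) x (m : M) : Prop :=
  idem (gtgt x) *: m = m /\ if x is inr a then forall b, I b a -> arr b *: m = 0 else True.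

Lemma valid_ann (M : lmodType A) x (m : M) :
  valid x m -> forall a : A, a * gen x = 0 -> a *: m = 0.
Proof.
case: x => [v|c] [em mc] a a0 /=; rewrite -em scalerA; first by rewrite a0 scale0r.
have [d ->] := Marr_eq0 a0; rewrite scaler_suml big1 // => b Ibc.
by rewrite -scalerA mc ?scaler0.
Qed.

Lemma gmod_hom_valid (M : lmodType A) x (m : M) : valid x m ->
  exists f : {linear gmod x -> M}, f (fgen x) = m.
Proof. by move=> /valid_ann/gmod_hom. Qed.

Lemma fgen_valid x : valid x (fgen x).
Proof.
split; first exact: idem_fgen.
case: x => // a b Iba; apply: fval_inj.
by rewrite fvalZ fval_gen linear0; exact: arrM0.
Qed.

Lemma hom_valid x (M N : lmodType A) (f : {linear M -> N}) m : valid x m -> valid x (f m).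
Proof.
case=> em mx; split; first by rewrite -linearZ em.
by case: x em mx => // a em mx b /mx; rewrite -linearZ => ->; exact: linear0.
Qed.

Lemma gmod_fin_generated x : fin_generated (gmod x).
Proof.
exists 1%N, (fun=> fgen x) => u; have [a ->] := gmod_elt u.
by exists (fun=> a); rewrite big_ord1.
Qed.

Lemma gmod_projective v : projective (gmod (inl v)).
Proof.
move=> X Y p f pS; have [z zE] := pS (f (fgen (inl v))).
have [|g gE] := @gmod_hom_valid X (inl v) (idem v *: z).
  by split=> //=; rewrite scalerA idem_idem.
exists g => m; apply: (gmod_hom_eq (f := p \o g) (h := f)).
by rewrite /= gE linearZ zE -linearZ; congr (f _); exact: (idem_fgen (inl v)).
Qed.

(** * Indecomposability and isomorphism classes of the left ideals *)

Lemma rad_pow1_fix (M : lmodType A) (r : A) (m : M) : rad_pow 1 r -> r *: m = m -> m = 0.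
Proof.
move=> /rad_pow1_unit[u uE] rm; rewrite -[m]scale1r -uE -scalerA scalerBl rm.
by rewrite scale1r subrr scaler0.
Qed.

(** The only possible path of length 0 in the corner is a trivial one, present when [v = w].
    Elements of [e_v A e_v] are thus scalars modulo the radical, which is the locality used
    below. *)
Lemma corner_dec v w (a : A) : exists2 r,
  rad_pow 1 r &
  idem v * a * idem w = (if v == w then kalg_in (cls_coef v [::] a) * idem v else 0) + r.
Proof.
exists (idem v * a * idem w - if v == w then kalg_in (cls_coef v [::] a) * idem v else 0);
  last by rewrite addrC subrK.
move=> u [|//] _; rewrite cls_coefB cls_coef_Midem cls_coef_idemM /path_end /=.
case: (eqVneq v w) => [<-|vw].
  rewrite cls_coefZ; case: (eqVneq u v) => [->|uv]; first by rewrite cls_coef_idem mulr1 subrr.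
  by rewrite cls_coef_cls xpair_eqE (negPf uv) mulr0 subrr.
rewrite cls_coef0 subr0; case: eqP => // ->.
by rewrite eq_sym (negPf vw).
Qed.

Lemma scaleK_inv (M : lmodType A) (k : K) (m : M) : k != 0 ->
  (kalg_in k : A) *: m = 0 -> m = 0.
Proof.
move=> k0 km; rewrite -[m]scale1r -(rmorph1 (@kalg_in K A)) -(mulVf k0) rmorphM.
by rewrite -scalerA km scaler0.
Qed.

Lemma gmod_nonzero x : ~ mod_zero (gmod x).
Proof. by move=> /(_ (fgen x)) h; apply: (@gen_neq0 x); rewrite -fval_gen h linear0. Qed.

(** Let [(g1, g2)] be the image of the generator and let [a] send it to [(g1, 0)]. If the trivial
    coordinate of [a] is zero, a radical element fixes [g1], so [g1 = 0]; otherwise [a] acts on [g2]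
    invertibly up to the radical and kills it, so [g2 = 0]. *)
Lemma gmod_indecomposable x : indecomposable (gmod x).
Proof.
split=> [|M1 M2 /mod_isoP[f [h [fh hf]]]]; first exact: gmod_nonzero.
pose g1 := (f (fgen x)).1; pose g2 := (f (fgen x)).2; pose e := idem (gtgt x).
have fgE (b : A) : f (b *: fgen x) = (b *: g1, b *: g2).
  by rewrite linearZ /= /g1 /g2; case: (f _).
have eg : e *: g1 = g1 /\ e *: g2 = g2.
  by have := fgE e; rewrite idem_fgen /g1 /g2; case: (f _) => u w [<- <-].
have elt (m : M1 * M2) : exists b : A, m = (b *: g1, b *: g2).
  by have [b bE] := gmod_elt (h m); exists b; rewrite -fgE -bE hf.
have [a [ag1 ag2]] := elt (g1, 0).
have [r r1 rE] := corner_dec (gtgt x) (gtgt x) a; rewrite eqxx -/e in rE.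
have eae m : e *: m = m -> a *: m = a *: m -> (e * a * e) *: m = e *: (a *: m).
  by move=> em _; rewrite -!scalerA em.
have rg1 : (e * a * e) *: g1 = g1 by rewrite eae ?(proj1 eg) // -ag1 (proj1 eg).
have rg2 : (e * a * e) *: g2 = 0.
  by rewrite -!scalerA (proj2 eg) -ag2 scaler0.
case: (eqVneq (cls_coef (gtgt x) [::] a) 0) => [l0|l0]; [left=> m|right=> m].
  have g10 : g1 = 0.
    by apply: (rad_pow1_fix r1); rewrite -[RHS]rg1 rE l0 rmorph0 mul0r add0r.
  by have [b [-> _]] := elt (m, 0); rewrite g10 scaler0.
have g20 : g2 = 0.
  apply: (rad_pow1_fix (r := - (kalg_in (cls_coef (gtgt x) [::] a)^-1 * r))).
    by apply: rad_powN; exact: rad_powZ.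
  apply/subr0_eq/(scaleK_inv l0); rewrite scalerBr scaleNr scalerN scalerA mulrA.
  rewrite -rmorphM mulfV // rmorph1 mul1r -opprD -[in X in _ + X](proj2 eg) scalerA.
  by rewrite addrC -scalerDl -rE rg2 oppr0.
by have [b [_ ->]] := elt (0, m); rewrite g20 scaler0.
Qed.

Hypothesis Iuniq_succ : forall a b b', I b a -> I b' a -> b = b'.
Hypothesis Iuniq_pred : forall b a a', I b a -> I b a' -> a = a'.

(** Otherwise [a'] would be radical, and composing with [h] would make the nonzero generator a
    radical multiple of itself. *)
Lemma gmod_iso_corner x y (f : {linear gmod x -> gmod y}) (h : {linear gmod y -> gmod x}) :
  cancel f h -> gtgt x = gtgt y /\
  exists2 a, f (fgen x) = a *: fgen y & cls_coef (gtgt y) [::] a != 0.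
Proof.
move=> fh; have [a aE] := gmod_elt (f (fgen x)); have [b bE] := gmod_elt (h (fgen y)).
pose a' := idem (gtgt x) * a * idem (gtgt y).
have a'E : f (fgen x) = a' *: fgen y.
  by rewrite -!scalerA idem_fgen -aE -linearZ idem_fgen.
have abE : (a' * b) *: fgen x = fgen x by rewrite -scalerA -bE -linearZ -a'E fh.
have a'1 : ~ rad_pow 1 a'.
  by move=> /(rad_powMr b)/rad_pow1_fix/(_ abE) => h0; apply: (@gmod_nonzero x) => u;
     have [c ->] := gmod_elt u; rewrite h0 scaler0.
have [r r1 rE] := corner_dec (gtgt x) (gtgt y) a.
case: (eqVneq (gtgt x) (gtgt y)) rE => [xy|_] rE; last first.
  by case: a'1; rewrite /a' rE add0r.
split=> //; exists a => //; apply: contra_notN a'1 => /eqP a0.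
by rewrite /a' rE xy a0 rmorph0 mul0r add0r.
Qed.

(** A successor [b] of [c] kills the generator of [A c], hence also its image [a * gen y]. As [a]
    has a nonzero trivial part, [b] must form a relation with [gen y]; so [y] is an arrow, and it is
    [c] by uniqueness. *)
Lemma gmod_iso_inr c y : has_succ (inr c) -> mod_iso (gmod (inr c)) (gmod y) -> inr c = y.
Proof.
move=> [b Ibc] /mod_isoP[f [h [fh _]]].
have [cy [a aE a0]] := gmod_iso_corner fh.
have : arr b * (a * gen y) = 0.
  have [_ /(_ b Ibc)/(congr1 (fval y))] := hom_valid f (fgen_valid (inr c)).
  by rewrite aE !fvalZ fval_gen linear0.
have bc : src b = gtgt y by rewrite -cy /= (Icomp Ibc).
move=> /(congr1 (cls_coef (tgt b) (b :: glist y)));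
  rewrite cls_coef_arrM_cons bc cls_coef_gen cls_coef0.
have [nz|nz] := boolP (nonzero_path I (tgt b) (b :: glist y)).
  by rewrite mulr1n => /eqP; rewrite (negPf a0).
move=> _; case: y cy f h fh a aE a0 bc nz => [v|c'] /= cy f h fh a aE a0 bc nz.
  by rewrite /nonzero_path /= eqxx in nz.
by move: nz; rewrite /nonzero_path /= eqxx bc eqxx /= andbT negbK => /(Iuniq_pred Ibc) ->.
Qed.

Lemma gmod_iso_inj x y : has_succ x -> has_succ y -> mod_iso (gmod x) (gmod y) -> x = y.
Proof.
case: x y => [v|a] [w|b] hx hy.
- by move=> /mod_isoP[f [h [fh _]]]; have [/= vw _] := gmod_iso_corner fh; rewrite vw.
- by move=> /mod_iso_sym/(gmod_iso_inr hy).
- exact: gmod_iso_inr.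
- exact: gmod_iso_inr.
Qed.

(** * Torsionless modules *)

Lemma left_dec (c : A) : exists d : arrow Q -> A,
  (forall a, idem (src a) * d a = d a) /\
  c = \sum_v kalg_in (cls_coef v [::] c) * idem v + \sum_a arr a * d a.
Proof.
elim/bound_path_ind: c => [|c c' [d [dE cE]] [d' [dE' cE']]|k c [d [dE cE]]|v s vs].
- exists (fun=> 0); split=> [a|]; first exact: mulr0.
  rewrite !big1 ?addr0 // => [a _|v _]; first exact: mulr0.
  by rewrite cls_coef0 rmorph0 mul0r.
- exists (fun a => d a + d' a); split=> [a|]; first by rewrite mulrDr dE dE'.
  rewrite {1}cE {1}cE' addrACA; congr (_ + _); rewrite -big_split; apply: eq_bigr => a _.
    by rewrite cls_coefD rmorphD mulrDl.
  by rewrite mulrDr.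
- exists (fun a => kalg_in k * d a); split=> [a|]; first by rewrite kalg_inMl dE.
  rewrite {1}cE mulrDr; congr (_ + _); rewrite mulr_sumr; apply: eq_bigr => a _.
    by rewrite cls_coefZ rmorphM mulrA.
  by rewrite kalg_inMl.
case: s vs => [|b s] vs.
  exists (fun=> 0); split=> [a|]; first exact: mulr0.
  rewrite (bigD1 v) // cls_coef_cls eqxx rmorph1 mul1r big1 ?big1 => [|a _|w wv].
  - by rewrite addr0; exact/esym/addr0.
  - exact: mulr0.
  have -> : cls_coef w [::] (path_cls v [::]) = 0.
    by rewrite cls_coef_cls xpair_eqE (negPf wv) mul0rn.
  by rewrite rmorph0 mul0r.
have /eqP <- : tgt b == v by case/andP: vs => /andP[].
exists (fun a => if a == b then path_cls (src b) s else 0); split=> [a|].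
  case: eqP => [->|_]; last exact: mulr0.
  by rewrite path_clsM /path_end /= eqxx.
rewrite big1 ?add0r => [|w _]; last first.
  have -> : cls_coef w [::] (path_cls (tgt b) (b :: s)) = 0.
    by rewrite cls_coef_cls xpair_eqE andbF mul0rn.
  by rewrite rmorph0 mul0r.
rewrite (bigD1 b) //= eqxx -path_cls_cons big1 ?addr0 // => a /negPf->.
exact: mulr0.
Qed.

Lemma left_dec_hom v (c : A) : idem v * c = c -> exists d : arrow Q -> A,
  (forall a, idem (src a) * d a = d a) /\
  c = kalg_in (cls_coef v [::] c) * idem v + \sum_(a | tgt a == v) arr a * d a.
Proof.
move=> vc; have [d [dE cE]] := left_dec c; exists d; split=> //.
rewrite -{1}vc {1}cE mulrDr; congr (_ + _).
  rewrite (bigD1 v) // mulrDr kalg_inMl idem_idem mulr_sumr big1 ?addr0 // => w wv.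
  by rewrite kalg_inMl idemM eq_sym (negPf wv) mulr0.
rewrite mulr_sumr [RHS]big_mkcond; apply: eq_bigr => a _.
by rewrite mulrA idem_arr eq_sym; case: ifP => // _; rewrite mul0r.
Qed.

Lemma cls_coef_arrM_head w a s b (z : A) : a != b -> cls_coef w (a :: s) (arr b * z) = 0.
Proof. by move=> /negPf ab; rewrite cls_coef_arrM ab mulr0n. Qed.

Section TorsionlessModule.
Variable M : lmodType A.
Hypothesis Mtl : torsionless M.

Lemma functionalZ (f : {linear M -> A^o}) (c : A) m : f (c *: m) = c * f m.
Proof. exact: linearZ. Qed.

(** Under any functional the summands become combinations of paths with different first arrows, so
    their supports in the path basis are disjoint. *)
Lemma torsionless_arr_sum (m : arrow Q -> M) :
  \sum_a arr a *: m a = 0 -> forall a, arr a *: m a = 0.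
Proof.
move=> m0 b; apply: Mtl => f; rewrite functionalZ; apply: cls_coef_eq0 => v [|c s] _.
  by rewrite cls_coef_arrM.
case: (eqVneq c b) => [->|cb]; last exact: cls_coef_arrM_head.
have := congr1 (fun m => cls_coef v (b :: s) (f m)) m0.
rewrite linear_sum linear0 cls_coef0 cls_coef_sum (bigD1 b) // functionalZ /=.
rewrite big1 ?addr0 // => a ab.
by rewrite functionalZ; apply: cls_coef_arrM_head; rewrite eq_sym.
Qed.

Section Family.
Variables (J : finType) (D : {set J}) (tau : J -> gtype) (g : J -> M).

Definition family_gen := forall m : M, exists c : J -> A, m = \sum_(j in D) c j *: g j.
Definition family_ok :=
  [/\ forall j, has_succ (tau j), forall j, valid (tau j) (g j) & family_gen].
(* Minimizing this prefers fewer generators, then generators of type [A a] over type [A e_v]. *)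
Definition family_size := (\sum_(j in D) (if tau j is inl _ then 2 else 1))%N.

(** At the vertex of [g i], the coefficient [c i] is a nonzero scalar plus a radical element;
    dividing by the scalar and inverting one plus a radical element solves the equation for
    [g i]. *)
Lemma exchange (m : M) (c : J -> A) i : i \in D -> valid (tau i) (g i) ->
  m = \sum_(j in D) c j *: g j -> cls_coef (gtgt (tau i)) [::] (c i) != 0 ->
  exists (p : A) (b : J -> A), g i = p *: m + \sum_(j in D :\ i) b j *: g j.
Proof.
move=> iD [eg _] mE l0; set v := gtgt (tau i) in eg l0.
have [r r1 rE] := corner_dec v v (c i); rewrite eqxx in rE.
set l := cls_coef v [::] (c i) in l0 rE.
(* The double sign gives the factor the shape [1 - r] expected by [rad_pow1_unit]. *)
have gE : (1 - - (kalg_in l^-1 * r)) *: g i =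
    (kalg_in l^-1 * idem v) *: m
      + \sum_(j in D :\ i) (- (kalg_in l^-1 * idem v * c j)) *: g j.
  rewrite mE (big_setD1 i) // scalerDr scaler_sumr -addrA -big_split big1; last first.
    by move=> j _; rewrite scalerA scaleNr; exact: subrr.
  rewrite addr0 -[in X in _ = _ *: (_ *: X)]eg !scalerA -!mulrA (mulrA _ (c i)) rE mulrDr scalerDl.
  rewrite opprK scalerDl scale1r; congr (_ + _).
  by rewrite mulrA -(rmorphM (@kalg_in K A)) mulVf // rmorph1 mul1r eg.
have /rad_pow1_unit[u uE] : rad_pow 1 (- (kalg_in l^-1 * r)) by apply: rad_powN; exact: rad_powZ.
exists (u * (kalg_in l^-1 * idem v)), (fun j => u * - (kalg_in l^-1 * idem v * c j)).
rewrite -[LHS]scale1r -uE -scalerA gE scalerDr scalerA scaler_sumr; congr (_ + _).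
by apply: eq_bigr => j _; rewrite scalerA.
Qed.
End Family.

Section MinimalFamily.
Variables (J : finType) (D : {set J}) (tau : J -> gtype) (g : J -> M).
Hypothesis fam : family_ok D tau g.
Hypothesis fam_min : forall (D' : {set J}) (tau' : J -> gtype) (g' : J -> M),
  family_ok D' tau' g' -> (family_size D tau <= family_size D' tau')%N.

(** Otherwise [exchange] with [m = 0] expresses [g i] by the other generators, and [D :\ i] carries
    a smaller family. *)
Lemma minimal_no_unit (c : J -> A) : \sum_(j in D) c j *: g j = 0 ->
  forall i, i \in D -> cls_coef (gtgt (tau i)) [::] (c i) = 0.
Proof.
case: fam => hs va gen_D c0 i iD; apply/eqP/negPn/negP => l0.
have [p [b]] := exchange iD (va i) (esym c0) l0; rewrite scaler0 add0r => gE.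
have := fam_min (D' := D :\ i) (tau' := tau) (g' := g).
rewrite /family_size [X in (X <= _)%N](big_setD1 i) //= => h.
suff /h : family_ok (D :\ i) tau g by case: (tau i) => ?; rewrite leqNgt ?ltnS ?leqnn ?leqnSn.
split=> // m; have [d ->] := gen_D m; exists (fun j => d i * b j + d j).
rewrite (big_setD1 i) //= {1}gE scaler_sumr -big_split; apply: eq_bigr => j _.
by rewrite scalerA scalerDl.
Qed.

(** By [exchange], [m] can take the place of [g i]. If [g i] had type [A e_v], this would replace a
    weight 2 by a weight 1. *)
Lemma minimal_no_convert (m : M) (c : J -> A) i a : i \in D -> m = \sum_(j in D) c j *: g j ->
  cls_coef (gtgt (tau i)) [::] (c i) != 0 -> has_succ (inr a) -> valid (inr a) m ->
  if tau i is inl _ then False else True.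
Proof.
case: fam => hs va gen_D iD mE l0 ha vm; case Et : (tau i) => [v|//].
have [p [b gE]] := exchange iD (va i) mE l0.
pose tau' j := if j == i then inr a else tau j; pose g' j := if j == i then m else g j.
have := fam_min (D' := D) (tau' := tau') (g' := g').
rewrite /family_size !(big_setD1 i iD) /= Et /tau' eqxx.
rewrite [in X in _ -> (_ <= X)%N](eq_bigr (fun j => if tau j is inl _ then 2 else 1)%N);
  last first.
  by move=> j; rewrite !inE => /andP[/negPf-> _].
rewrite leq_add2r /= => h; have : false; last by []; apply: h.
rewrite -/tau'; split=> [j|j|n]; rewrite /tau' /g'; [by case: eqP|by case: eqP|].
have [d ->] := gen_D n.
exists (fun j => if j == i then d i * p else d i * b j + d j).
rewrite [LHS](big_setD1 i) //= [RHS](big_setD1 i) //= eqxx {1}gE scalerDr scalerA -addrA.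
congr (_ + _); rewrite scaler_sumr -big_split; apply: eq_bigr => j.
by rewrite !inE => /andP[/negPf-> _] /=; rewrite scalerA scalerDl.
Qed.

Lemma killed_functional (b : arrow Q) (m : M) (f : {linear M -> A^o}) : arr b *: m = 0 ->
  exists d : arrow Q -> A, idem (src b) * f m = \sum_(a | I b a) arr a * d a.
Proof.
by move=> bm; apply: arrM_eq0; have := congr1 f bm; rewrite linearZ linear0.
Qed.

(** A combination killed by [b] is turned into an honest relation without changing the products with
    [b]: the terms of the coefficients that [b] kills on the generators are dropped. What remains is
    still killed by [b], yet has no path whose first arrow forms a relation with [b], so every
    functional sends it to 0. *)
Lemma minimal_step (b : arrow Q) (c : J -> A) :
  (forall j, idem (src b) * c j = c j) -> arr b *: (\sum_(j in D) c j *: g j) = 0 ->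
  exists c' : J -> A, \sum_(j in D) c' j *: g j = 0 /\
    forall j, j \in D -> arr b * c' j * gen (tau j) = arr b * c j * gen (tau j).
Proof.
case: fam => hs va gen_D cb; set m := (\sum_(j in D) _) => bm; set v := src b in cb.
have vm : idem v *: m = m.
  by rewrite scaler_sumr; apply: eq_bigr => j _; rewrite scalerA cb.
(* If some [a] has [I b a], then [m] is valid for the type [A a] and [minimal_no_convert] applies;
   if there is none, every functional kills [m], so [m = 0] and [minimal_no_unit] excludes a nonzero
   scalar part. *)
have noinl i : i \in D -> gtgt (tau i) = v -> cls_coef v [::] (c i) != 0 ->
    if tau i is inl _ then False else True.
  move=> iD vi l0; have [[a Iba]|noa] := pselect (exists a, I b a).
    apply: (minimal_no_convert (m := m) (c := c) (a := a)) => //; first by rewrite vi.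
      by exists b.
    split=> /=; first by rewrite (Icomp Iba).
    by move=> b' /(Iuniq_succ Iba) <-.
  have m0 : m = 0.
    apply: Mtl => f; have [d] := killed_functional f bm.
    rewrite big1 => [|a Iba]; last by case: noa; exists a.
    by rewrite -/v -functionalZ vm.
  by have := minimal_no_unit m0 iD; rewrite vi => /eqP; rewrite (negPf l0).
have /choice[d dE] := fun j => left_dec_hom (cb j).
(* These are the indices whose scalar part may survive multiplication by [b]; by [noinl], those in
   [D] have an arrow as type. *)
pose bad j := [&& gtgt (tau j) == v, cls_coef v [::] (c j) != 0
  & if tau j is inr a then ~~ I b a else true].
pose c' j := (if bad j then kalg_in (cls_coef v [::] (c j)) * idem v else 0)
  + \sum_(a | (tgt a == v) && ~~ I b a) arr a * d j a.
have c'E j : j \in D -> arr b * c' j * gen (tau j) = arr b * c j * gen (tau j).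
  move=> jD; have [_ cE] := dE j.
  rewrite [in RHS]cE /c' !mulrDr !mulrDl; congr (_ + _); last first.
    congr (_ * _); rewrite [in RHS](bigID (I b)) /= mulrDr.
    rewrite [X in X + _]mulr_sumr [X in X + _]big1 ?add0r // => a /andP[_ Iba].
    by rewrite mulrA arrM0 // mul0r.
  case: ifP => // /negbT; rewrite mulr0 mul0r !negb_and !negbK.
  rewrite kalg_inMl -mulrA -[in RHS]mulrA => /or3P[vj|/eqP->|].
  - by rewrite -idem_gen (mulrA (idem v)) idemM eq_sym (negPf vj) mul0r !mulr0.
  - by rewrite rmorph0 mul0r.
  case: (eqVneq (gtgt (tau j)) v) => [vj|vj]; last first.
    by rewrite -idem_gen (mulrA (idem v)) idemM eq_sym (negPf vj) mul0r !mulr0.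
  have [->|l0] := eqVneq (cls_coef v [::] (c j)) 0; first by rewrite rmorph0 mul0r.
  have := noinl j jD vj l0; case: (tau j) vj => // a /= <- _; rewrite negbK => Iba.
  by rewrite idem_arr eqxx arrM0 // mulr0.
exists c'; split=> //.
set u := (\sum_(j in D) c' j *: g j).
have bu : arr b *: u = 0.
  rewrite -bm !scaler_sumr; apply: eq_bigr => j jD; apply/subr0_eq.
  rewrite !scalerA -scalerBl; apply: (valid_ann (va j)).
  by rewrite mulrBl c'E // subrr.
have vu : idem v *: u = u.
  rewrite scaler_sumr; apply: eq_bigr => j _; rewrite scalerA; congr (_ *: _).
  rewrite mulrDr; congr (_ + _).
    by case: ifP; rewrite ?mulr0 // kalg_inMl idem_idem.
  rewrite mulr_sumr; apply: eq_bigr => a /andP[/eqP av _].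
  by rewrite mulrA idem_arr av eqxx.
apply: Mtl => f; have [z] := killed_functional f bu.
have -> : idem (src b) * f u = f u by rewrite -functionalZ vu.
move=> fE; apply: cls_coef_eq0 => w [|a s] _.
  by rewrite fE cls_coef_sum big1 // => a _; rewrite cls_coef_arrM.
(* By [fE], only paths with a first arrow [a] such that [I b a] can occur in [f u]. The summands of
   [u] give other first arrows: this is clear for the arrow terms, and for a scalar term with
   [tau j = inr a'] the value [f (g j)] lies in [arr a' * A]. *)
have [Iba|Iba] := boolP (I b a); last first.
  rewrite fE cls_coef_sum big1 // => a' Iba'; apply: cls_coef_arrM_head.
  by apply: contraNneq Iba => ->.
rewrite linear_sum cls_coef_sum big1 // => j jD.
rewrite functionalZ mulrDl cls_coefD mulr_suml cls_coef_sum.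
rewrite [X in _ + X]big1 ?addr0 => [|a' /andP[_ Iba']]; last first.
  by rewrite -mulrA; apply: cls_coef_arrM_head; apply: contraNneq Iba' => <-.
case: ifP; last by rewrite mul0r cls_coef0.
move=> /and3P[/eqP vj l0]; rewrite -mulrA cls_coefZ.
have := noinl j jD vj l0; have := hs j; have := va j.
case Et : (tau j) vj => [//|a'] /= vj [_ kj] [b' Iba'] _ Iba''.
have [z' z'E] := killed_functional f (kj b' Iba').
rewrite -vj (Icomp Iba') z'E cls_coef_sum big1 ?mulr0 // => a'' Iba1.
apply: cls_coef_arrM_head; apply: contraNneq Iba'' => aE.
by rewrite (Iuniq_pred Iba' Iba1) -aE.
Qed.

(* Nakayama: modulo relations that vanish in the direct sum, a relation lies in every power of the
   radical. *)
Lemma minimal_deep k (c : J -> A) : \sum_(j in D) c j *: g j = 0 ->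
  exists c' : J -> A, (forall j, rad_pow k (c' j)) /\
    forall j, j \in D -> c' j * gen (tau j) = c j * gen (tau j).
Proof.
elim: k c => [|k IHk] c c0; first by exists c.
case: fam => hs va gen_D; have nu := minimal_no_unit c0.
have /choice[d dE] := fun j => left_dec (c j).
have cE j : j \in D -> c j * idem (gtgt (tau j)) = \sum_a arr a * (d j a * idem (gtgt (tau j))).
  move=> jD; rewrite {1}(proj2 (dE j)) mulrDl !mulr_suml.
  rewrite [X in X + _]big1 ?add0r => [|w _]; first by apply: eq_bigr => a _; rewrite mulrA.
  rewrite -mulrA idemM; case: eqP => [->|_]; last exact: mulr0.
  by rewrite nu // rmorph0 mul0r.
(* The relation becomes [\sum_a arr a *: y a = 0] and splits arrow by arrow. Then [minimal_step]
   replaces each [y a] by a relation, to which the induction hypothesis applies. *)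
pose y a := \sum_(j in D) d j a *: g j.
have y0 : \sum_a arr a *: y a = 0.
  transitivity (\sum_a \sum_(j in D) arr a *: (d j a *: g j)).
    by apply: eq_bigr => a _; exact: scaler_sumr.
  rewrite exchange_big -[RHS]c0; apply: eq_bigr => j jD.
  have [eg _] := va j.
  transitivity ((c j * idem (gtgt (tau j))) *: g j); last by rewrite -scalerA eg.
  by rewrite cE // scaler_suml; apply: eq_bigr => a _; rewrite -!scalerA eg.
have /choice[e eE] : forall a, exists e : J -> A, (forall j, rad_pow k (e j)) /\
    forall j, j \in D -> arr a * e j * gen (tau j) = arr a * d j a * gen (tau j).
  move=> a; have [c1 [c10 c1E]] := minimal_step (b := a) (c := d^~ a)
    (fun j => proj1 (dE j) a) (torsionless_arr_sum y0 a).
  have [c2 [c2k c2E]] := IHk _ c10; exists c2; split=> // j jD.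
  by rewrite -mulrA c2E // mulrA c1E.
exists (fun j => \sum_a arr a * e a j); split=> [j|j jD].
  apply: rad_pow_sum => a _; rewrite -add1n; apply: rad_powM; first exact: rad_pow_arr.
  by case: (eE a).
rewrite -[X in _ = _ * X]idem_gen mulrA cE // !mulr_suml; apply: eq_bigr => a _.
by rewrite (proj2 (eE a)) // -!mulrA idem_gen.
Qed.

Lemma minimal_free (c : J -> A) : \sum_(j in D) c j *: g j = 0 ->
  forall j, j \in D -> c j * gen (tau j) = 0.
Proof.
have [k kE] := rad_pow_nilp; move=> /(minimal_deep k)[c' [c'k c'E]] j jD.
by rewrite -(c'E j jD) (kE _ (c'k j)) mul0r.
Qed.

End MinimalFamily.

(** The elements [e_v h_i] form a first family, with all types [A e_v]. The index type [J] is fixed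
    by it, since deleting or replacing a generator stays within [J]. *)
Lemma minimal_family : fin_generated M -> exists (J : finType) (D : {set J}) tau g,
  family_ok D tau g /\ forall (D' : {set J}) tau' (g' : J -> M),
    family_ok D' tau' g' -> (family_size D tau <= family_size D' tau')%N.
Proof.
move=> [n [h hP]]; pose J : finType := ('I_n * vertex Q)%type.
pose P k := exists (D : {set J}) tau (g : J -> M), family_ok D tau g /\ family_size D tau = k.
have exP : exists k, `[< P k >].
  exists (family_size [set: J] (fun j => inl j.2)); apply/asboolP.
  exists [set: J], (fun j => inl j.2), (fun j => idem j.2 *: h j.1); split=> //.
  split=> // [j|m]; first by split=> //=; rewrite scalerA idem_idem.
  have [c ->] := hP m; exists (fun j => c j.1).
  transitivity (\sum_(i < n) \sum_v c i *: (idem v *: h i)).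
    by apply: eq_bigr => i _; rewrite -scaler_sumr -scaler_suml sum_idem scale1r.
  by rewrite pair_bigA; apply: eq_bigl => j; rewrite inE.
case: (ex_minnP exP) => k /asboolP[D [tau [g [fam fk]]]] kmin.
exists J, D, tau, g; split=> // D' tau' g' fam'; rewrite fk; apply: kmin; apply/asboolP.
by exists D', tau', g'.
Qed.

(** By [minimal_free], [M] is the direct sum of [gmod (tau i)] and the span [N] of the other
    generators; the first summand is nonzero, so [N] vanishes. *)
Lemma torsionless_indecomposable : fin_generated M -> indecomposable M ->
  exists2 x, has_succ x & mod_iso M (gmod x).
Proof.
move=> /minimal_family[J [D [tau [g [fam famin]]]]] [Mn0 Mind].
have free := minimal_free fam famin; have [hs va gen_D] := fam.
have [i iD] : exists i, i \in D.
  apply/set0Pn; apply: contra_notN Mn0 => /eqP D0 m.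
  by have [c ->] := gen_D m; rewrite D0 big_set0.
exists (tau i) => //; apply: mod_iso_sym.
pose S m := exists c : J -> A, m = \sum_(j in D :\ i) c j *: g j.
have S0 : S 0 by exists (fun=> 0); rewrite big1 // => j _; exact: scale0r.
have SD m n : S m -> S n -> S (m + n).
  move=> [c ->] [c' ->]; exists (fun j => c j + c' j).
  by rewrite -big_split; apply: eq_bigr => j _; rewrite scalerDl.
have SZ (a : A) m : S m -> S (a *: m).
  move=> [c ->]; exists (fun j => a * c j).
  by rewrite scaler_sumr; apply: eq_bigr => j _; rewrite scalerA.
pose SS : submodule M := Submodule S0 SD SZ; pose N := submod SS.
have [f fE] := gmod_hom_valid (va i).
have fc (c : J -> A) : f (c i *: fgen (tau i)) + \sum_(j in D :\ i) c j *: g j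
    = \sum_(j in D) c j *: g j.
  by rewrite linearZ fE [RHS](big_setD1 i).
have zero (c : J -> A) : f (c i *: fgen (tau i)) + \sum_(j in D :\ i) c j *: g j = 0 ->
    c i *: fgen (tau i) = 0 /\ \sum_(j in D :\ i) c j *: g j = 0.
  rewrite fc => /free c0; split.
    by apply: fval_inj; rewrite fvalZ fval_gen c0 // linear0.
  rewrite big1 // => j /setD1P[_ jD]; apply: (valid_ann (va j)); exact: c0.
have hL : linear (fun p : gmod (tau i) * N => f p.1 + sub_val p.2).
  by move=> a p q; rewrite !linearD !linearZ /= scalerDr addrACA.
have iso : mod_iso (gmod (tau i) * N)%type M.
  apply: (linear_bij (f := lin_of hL)) => [[u n]|m]; last first.
    have [c ->] := gen_D m.
    have Sc : SS (\sum_(j in D :\ i) c j *: g j) by exists c.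
    by exists (c i *: fgen (tau i), smk Sc : N); rewrite lin_ofE /= -fc.
  change (f u + sub_val n = 0 -> (u, n) = 0).
  have [a ->] := gmod_elt u; have [c cE] := sub_valP n.
  pose c' j := if j == i then a else c j.
  have c'E : \sum_(j in D :\ i) c' j *: g j = sub_val n.
    by rewrite cE; apply: eq_bigr => j /setD1P[/negPf ji _]; rewrite /c' ji.
  rewrite -c'E -[a in a *: _](_ : c' i = a); last by rewrite /c' eqxx.
  move=> /zero[-> n0]; congr (_, _); apply: sub_val_inj.
  by rewrite -c'E n0 linear0.
case: (Mind _ _ (mod_iso_sym iso)) => [/gmod_nonzero//|N0].
apply: (linear_bij (f := f)) => [u|m].
  have [a ->] := gmod_elt u => fa; have := zero (fun j => if j == i then a else 0).
  rewrite eqxx fa big1 ?addr0 => [/(_ erefl)[]//|j /setD1P[/negPf-> _]].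
  exact: scale0r.
have [c ->] := gen_D m; exists (c i *: fgen (tau i)); rewrite -fc.
have Sc : SS (\sum_(j in D :\ i) c j *: g j) by exists c.
by have := congr1 sub_val (N0 (smk Sc)); rewrite linear0 smkK => ->; rewrite addr0.
Qed.

End TorsionlessModule.

(** * Relation cycles and Gorenstein projectives *)

Lemma rel_traject (e : rel (arrow Q)) (s : arrow Q -> arrow Q) c n :
  (forall k, e (iter k s c) (iter k.+1 s c)) -> path e c (traject s (s c) n).
Proof.
elim: n c => //= n IHn c es; rewrite (es 0%N) IHn // => k.
by rewrite -!iterSr; exact: (es k.+1).
Qed.

(** The orbit is finite, and [Iuniq_pred] makes [s] injective along it, so the first repetition is a
    return to [c]. The orbit is reversed since each iterate stands to the left of the previous one
    in [I]. *)
Lemma cyclic_orbit (s : arrow Q -> arrow Q) c :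
  (forall k, I (iter k.+1 s c) (iter k s c)) -> cyclic_arrow I c.
Proof.
move=> Is; apply/asboolP.
have /trajectP[i] := looping_order s c.
have := orbit_uniq s c; rewrite /orbit -orderSpred; set n := (fingraph.order s c).-1 => un.
case: i => [|i] ltin nE; last first.
  have Ini : iter n s c = iter i s c.
    by apply: (@Iuniq_pred (iter n.+1 s c)); [exact: Is|rewrite nE; exact: Is].
  have := nth_uniq c (s := traject s c n.+1) (i := n) (j := i).
  rewrite size_traject ltnSn (ltnW ltin) un => /(_ isT isT isT).
  rewrite !nth_traject ?(ltnW ltin) // Ini eqxx => /esym/eqP ni.
  by rewrite ltnS ni ltnn in ltin.
exists (rev (traject s c n.+1)); last by rewrite mem_rev mem_head.
split; [by rewrite -size_eq0 size_rev size_traject|by rewrite rev_uniq|].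
rewrite rev_cycle /= -[X in rcons _ X]nE iterSr -trajectSr.
by apply: (rel_traject (e := fun b a => I a b)) => k; exact: Is.
Qed.

Lemma cyclic_arrow_nbrs c : cyclic_arrow I c ->
  (exists2 b, I b c & cyclic_arrow I b) /\ (exists2 a, I c a & cyclic_arrow I a).
Proof.
move=> /asboolP[l [l0 lu lI] cl]; split.
  exists (prev l c); first exact: (prev_cycle lI cl).
  by apply/asboolP; exists l => //; rewrite mem_prev.
exists (next l c); first exact: (next_cycle lI cl).
by apply/asboolP; exists l => //; rewrite mem_next.
Qed.

(** Neighbours in [I] are unique, so those of a cyclic arrow lie on its cycle. Hence no relation
    mixes cyclic and non-cyclic arrows, and [aus_rel] accounts for all of [I]. *)
Lemma cyclic_arrow_pred b a : I b a -> cyclic_arrow I b = cyclic_arrow I a.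
Proof.
move=> Iba; apply/idP/idP => /cyclic_arrow_nbrs[].
  by move=> _ [a' Iba' ?]; rewrite (Iuniq_pred Iba Iba').
by move=> [b' Iba' ?] _; rewrite (Iuniq_succ Iba Iba').
Qed.

Lemma cyclic_sequence c : cyclic_arrow I c -> exists al : int -> arrow Q,
  I c (al 0) /\ forall i, I (al i) (al (i + 1)).
Proof.
move=> cc; have [_ [c0 Icc0 cc0]] := cyclic_arrow_nbrs cc.
have /choice[s sP] : forall b, exists a, cyclic_arrow I b -> I a b /\ cyclic_arrow I a.
  move=> b; have [/cyclic_arrow_nbrs[[a]]|//] := boolP (cyclic_arrow I b); first by exists a.
  by exists b.
have /choice[p pP] : forall b, exists a, cyclic_arrow I b -> I b a /\ cyclic_arrow I a.
  move=> b; have [/cyclic_arrow_nbrs[_ [a]]|//] := boolP (cyclic_arrow I b); first by exists a.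
  by exists b.
have sk k : cyclic_arrow I (iter k s c0) by elim: k => //= k /sP[].
have pk k : cyclic_arrow I (iter k p c0) by elim: k => //= k /pP[].
(* The cycle is unrolled in both directions, by [p] to the right of [c0] and by [s] to the left;
   uniqueness places [c] at index -1. *)
exists (fun i => match i with Posz n => iter n p c0 | Negz n => iter n.+1 s c0 end).
split=> // -[n|[|n]].
- by rewrite -PoszD addn1; case: (pP _ (pk n)).
- by case: (sP _ cc0).
have -> : Negz n.+1 + 1 = Negz n by rewrite !NegzE -[n.+2]addn1 PoszD opprD subrK.
by case: (sP _ (sk n.+1)).
Qed.

Lemma rmul_kernel b a (u : gmod (inl (tgt a))) : I b a ->
  fval _ u * arr a = 0 <-> exists c, fval _ u = c * arr b.
Proof.
move=> Iba; split=> [ua|[c ->]]; last by rewrite -mulrA arrM0 ?mulr0.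
have [d] := Marr_eq0 ua; rewrite (bigD1 b) // big1 => [|b' /andP[Ib'a]]; last first.
  by rewrite (Iuniq_succ Ib'a Iba) eqxx.
move=> uE; exists (d b); rewrite -[RHS](addr0 _) -[RHS]uE; have [e ->] := gmod_elt u.
by rewrite fvalZ fval_gen -mulrA idem_idem.
Qed.

(** The complete resolution has [A e_(tgt (al i))] in degree [i] and right multiplication by [al i]
    as differential; the kernel in degree 0 is [A c]. *)
Lemma gmod_cyclic_Gproj c : cyclic_arrow I c -> Gproj (gmod (inr c)).
Proof.
move=> /cyclic_sequence[al [Ical Ial]]; split; first exact: gmod_fin_generated.
pose t i : gtype := inl (tgt (al i)).
have stE i : src (al i) = tgt (al (i + 1)) by rewrite -(Icomp (Ial i)).
have dP i : exists d : {linear gmod (t i) -> gmod (t (i + 1))},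
    forall u, fval (t (i + 1)) (d u) = fval (t i) u * arr (al i).
  apply: gmod_rmul; exists (arr (al i)).
  by rewrite /= idem_arr eqxx arr_idem stE eqxx.
pose d i := proj1_sig (cid (dP i)).
have dE i u : fval (t (i + 1)) (d i u) = fval (t i) u * arr (al i).
  by rewrite /d; case: cid => /= f ->.
have dgen i : d i (fgen (t i)) = arr (al i) *: fgen (t (i + 1)).
  apply: fval_inj; rewrite dE fvalZ !fval_gen /= idem_arr eqxx.
  by rewrite arr_idem stE eqxx.
have ex i (u : gmod (t (i + 1))) : d (i + 1) u = 0 <-> exists z, u = d i z.
  have -> : d (i + 1) u = 0 <-> exists z, fval (t (i + 1)) u = z * arr (al i).
    rewrite -(rmul_kernel u (Ial i)) -dE; split=> [->|u0]; first exact: linear0.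
    by apply: fval_inj; rewrite u0 linear0.
  split=> [[b bE]|[y ->]]; last by exists (fval (t i) y).
  exists (b *: fgen (t i)); apply: fval_inj.
  by rewrite bE dE fvalZ fval_gen -mulrA idem_arr eqxx.
exists (fun i => gmod (t i)), d; split=> //.
- by move=> i; split; [exact: gmod_fin_generated|exact: gmod_projective].
- move=> i f; split=> [f0|[g gE] u]; last first.
    by rewrite gE (_ : d _ _ = 0) ?linear0 //; apply/ex; exists u.
  (* The value of [f] at the generator is killed by [al i] on the left, so by [arrM_eq0] and
     uniqueness it lies in [arr (al (i + 1)) * A]; the other factor is the value of [g] at its
     generator. *)
  have := f0 (fgen (t i)); rewrite dgen functionalZ => /arrM_eq0[z].
  rewrite (bigD1 (al (i + 1))) //= big1 ?addr0 => [|a /andP[Ia]]; last first.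
    by rewrite (Iuniq_pred Ia (Ial i)) eqxx.
  rewrite -functionalZ stE idem_fgen => fE.
  have [|g gE] := @gmod_hom_valid (A^o) (t (i + 1 + 1))
      (idem (tgt (al (i + 1 + 1))) * z (al (i + 1))).
    by split=> //=; rewrite -[_ *: _]/(_ * _) mulrA idem_idem.
  exists g; apply: (gmod_hom_eq (h := g \o d (i + 1))).
  rewrite fE [RHS]/= dgen functionalZ gE mulrA arr_idem stE eqxx.
  by [].
have [|e eE] := @gmod_rmul (inr c) (t 0) 1.
  by exists (arr c); rewrite mulr1 /= arr_idem -(Icomp Ical) eqxx.
have {}eE u : fval (t 0) (e u) = fval (inr c) u by rewrite eE mulr1.
exists e => [u w ew|u]; first by apply: fval_inj; rewrite -eE ew eE.
have -> : d 0 u = 0 <-> exists z, fval (t 0) u = z * arr c.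
  rewrite -(rmul_kernel u Ical) -dE; split=> [->|u0]; first exact: linear0.
  by apply: fval_inj; rewrite u0 linear0.
split=> [[b bE]|[y ->]]; last first.
  by have [b ->] := gmod_elt y; exists b; rewrite eE fvalZ fval_gen.
by exists (b *: fgen (inr c)); apply: fval_inj; rewrite eE fvalZ fval_gen.
Qed.

Lemma syzygy_arrow b a : I b a ->
  exists (n : {linear gmod (inr b) -> gmod (inl (tgt a))})
    (p : {linear gmod (inl (tgt a)) -> gmod (inr a)}),
    syzygy n p /\ forall u, fval _ (n u) = fval _ u.
Proof.
move=> Iba.
have [|n nE] := @gmod_rmul (inr b) (inl (tgt a)) 1.
  by exists (arr b); rewrite mulr1 /= arr_idem (Icomp Iba) eqxx.
have [|p pE] := @gmod_rmul (inl (tgt a)) (inr a) (arr a).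
  by exists 1; rewrite mul1r /= idem_arr eqxx.
have {}nE u : fval _ (n u) = fval _ u by rewrite nE mulr1.
exists n, p; split=> //; split.
- exact: gmod_projective.
- move=> u; have [c ->] := gmod_elt u; exists (c *: fgen (inl (tgt a))).
  by apply: fval_inj; rewrite pE !fvalZ !fval_gen /= -mulrA idem_arr eqxx.
- by move=> u w nuw; apply: fval_inj; rewrite -nE nuw nE.
move=> u; have -> : p u = 0 <-> exists c, fval _ u = c * arr b.
  rewrite -(rmul_kernel u Iba) -pE; split=> [->|u0]; first exact: linear0.
  by apply: fval_inj; rewrite u0 linear0.
split=> [[c cE]|[y ->]]; last first.
  by have [c ->] := gmod_elt y; exists c; rewrite nE fvalZ fval_gen.
by exists (c *: fgen (inr b)); apply: fval_inj; rewrite nE fvalZ fval_gen.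
Qed.

(** Without a successor of [b], some functional on [A b] sends [b] to [e_(tgt b)]. An extension to
    [A e_(tgt a)] would write this idempotent as [b] times an element, but such a product has no
    trivial coordinate. *)
Lemma extends_has_succ b a (n : {linear gmod (inr b) -> gmod (inl (tgt a))}) : I b a ->
  (forall u, fval _ (n u) = fval _ u) -> extends n -> has_succ (inr b).
Proof.
move=> Iba nE ext; apply: contrapT => nosucc.
have [|f fE] := @gmod_hom (inr b) (A^o) (idem (tgt b)).
  move=> c /Marr_eq0[d]; rewrite big1 // => b' Ib'b.
  by case: nosucc; exists b'.
have [g gE] := ext f; have := gE (fgen (inr b)).
have -> : n (fgen (inr b)) = arr b *: fgen (inl (tgt a)).
  by apply: fval_inj; rewrite nE fvalZ !fval_gen /= arr_idem (Icomp Iba) eqxx.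
rewrite fE functionalZ => /(congr1 (cls_coef (tgt b) [::])).
by rewrite cls_coef_arrM cls_coef_idem => /eqP; rewrite eq_sym oner_eq0.
Qed.

(** Inductively [A (s^k c)] is a stable summand of the k-th syzygy in the resolution, whose
    extension property provides the next successor; so the chain never stops. *)
Lemma Gproj_cyclic c : has_succ (inr c) -> Gproj (gmod (inr c)) -> cyclic_arrow I c.
Proof.
move=> csucc /Gproj_syzygies[D [D0 Dstep]].
have /choice[s sP] : forall a, exists b, has_succ (inr a) -> I b a.
  move=> a; have [[b Iba]|na] := pselect (has_succ (inr a)); first by exists b.
  by exists a => /na.
have key k : has_succ (inr (iter k s c)) /\ stable_summand (gmod (inr (iter k s c))) (D k).
  elim: k => // k [/sP Isk Dk]; have [n [p [np nE]]] := syzygy_arrow Isk.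
  by have [? /(extends_has_succ Isk nE)] := Dstep _ _ _ _ n p np Dk.
by apply: (cyclic_orbit (s := s)) => k; apply: sP; case: (key k).
Qed.

Definition aus_type (x : aus_vertex I) : gtype :=
  match x with inl v => inl v | inr a => inr (val a) end.

Lemma aus_type_inj : injective aus_type.
Proof. by move=> [v|a] [w|b] //= [] => [->|/val_inj ->]. Qed.

Lemma aus_type_succ (x : aus_vertex I) : has_succ (aus_type x).
Proof.
case: x => // -[a ac]; have [[b Iba _] _] := cyclic_arrow_nbrs ac.
by exists b.
Qed.

Lemma aus_type_Gproj (x : aus_vertex I) : Gproj (gmod (aus_type x)).
Proof.
case: x => [v|[a ac]] /=; last exact: gmod_cyclic_Gproj.
by apply: projective_Gproj; [exact: gmod_fin_generated|exact: gmod_projective].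
Qed.

Lemma indecomposable_Gproj (M : lmodType A) : Gproj M -> indecomposable M ->
  exists x : aus_vertex I, mod_iso M (gmod (aus_type x)).
Proof.
move=> MG Mi; have [Mf _] := MG.
have [[v|a] xs xM] := torsionless_indecomposable (Gproj_torsionless MG) Mf Mi.
  by exists (inl v).
have ac : cyclic_arrow I a.
  by apply: Gproj_cyclic xs _; apply: Gproj_iso MG; exact: mod_iso_sym.
by exists (inr (exist _ a ac)).
Qed.

Lemma gentle_CM_finite : CM_finite A.
Proof.
exists #|aus_vertex I|, (fun i => gmod (aus_type (enum_val i))); split.
- by move=> i; split; [exact: aus_type_Gproj|exact: gmod_indecomposable].
- move=> i j /(gmod_iso_inj (aus_type_succ _) (aus_type_succ _))/aus_type_inj.
  exact: enum_val_inj.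
move=> M MG Mi; have [x xM] := indecomposable_Gproj MG Mi.
by exists (enum_rank x); rewrite enum_rankK.
Qed.

(** * The Cohen-Macaulay Auslander algebra *)

Implicit Types (p q : vertex (aus_quiver I)) (h : arrow (aus_quiver I)).
Implicit Types (r : seq (arrow (aus_quiver I))).

Lemma aus_rel_comp h h' : aus_rel I h h' -> tgt h' = src h.
Proof.
case: h h' => [b|[b|b]] [a|[a|a]] //= /Icomp ab; by [rewrite ab|rewrite /= ab].
Qed.

(* [a^+] is erased and [a^-] reads [a]. *)
Definition underlying r : seq (arrow Q) :=
  pmap (fun h : aus_arrow I => match h with
    inl a => Some (val a) | inr (inl _) => None | inr (inr a) => Some (val a) end) r.

(** By [gen_prod], this is the path of [Q] to which [r] sends the generator of [gmod (aus_type p)];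
    hence the arrow of a cyclic vertex [p] comes first. *)
Definition realize p r := glist (aus_type p) ++ underlying r.

Lemma realize_path p r : is_path p r -> is_path (gtgt (aus_type p)) (realize p r).
Proof.
rewrite /realize; elim: r p => [|h r IHr] p.
  by case: p => [v|a] /= _; rewrite ?eqxx.
by case: h => [a|[a|a]] /andP[/eqP<- /IHr] /=; rewrite ?eqxx.
Qed.

(* Elements of [A e_u] are combinations of paths starting at [u], those of [A c] of paths whose
   first arrow, the last of the list, is [c]. *)
Definition final_arrow p v l :=
  match p with inl u => path_end v l == u
  | inr c => if l is a :: l' then last a l' == val c else false end.

(** Two consecutive arrows in the reading that form a relation are both cyclic or both non-cyclic,
    and in either case [aus_rel] already forbids them in [r]. *)
Lemma realize_free p r : is_path p r -> relation_free (aus_rel I) r ->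
  relation_free I (realize p r).
Proof.
have head (a : arrow Q) r' : is_path (inl (src a) : vertex (aus_quiver I)) r' ->
    relation_free I (underlying r') ->
    (forall h r'', r' = h :: r'' -> match h : aus_arrow I with
      | inl b => I a (val b) -> False
      | inr (inl _) => True
      | inr (inr b) => I a (val b) -> False end) ->
    relation_free I (a :: underlying r').
  by case: r' => [//|[b|[//|b]] r''] _ rF /(_ _ _ erefl) Iab;
    apply/andP; split=> //; apply/negP.
elim: r p => [|h r IHr] p; first by case: p.
case: h => [a|[a|a]] /andP[/eqP<- rP] rF; have rF' := path_sorted rF.
- apply: (head (val a) r) => //; first exact: (IHr (inl (src (val a))) rP rF').
  move=> h r' rE; move: rP rF; rewrite rE /= => /andP[_ _] /andP[nI _].
  case: h nI rE => [b /negP//|[//|b]] _ _ Iab.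
  by have := valP a; rewrite /= (cyclic_arrow_pred Iab) (valP b).
- apply: (head (val a) r) => //; first exact: (IHr (inl (src (val a))) rP rF').
  move=> h r' rE; move: rP rF; rewrite rE /= => /andP[_ _] /andP[nI _].
  case: h nI rE => [b _|[//|b /negP//]] _ Iab.
  by have := valP b; rewrite /= -(cyclic_arrow_pred Iab) (valP a).
exact: (IHr (inr a) rP rF').
Qed.

(** In the list, [a^-] is always followed by [a^+], except at the end, where the end point of the
    path decides. Whether an arrow is cyclic decides between [a] and [a^-]. *)
Lemma underlying_inj p r r' : is_path p r -> is_path p r' -> path_end p r = path_end p r' ->
  underlying r = underlying r' -> r = r'.
Proof.
have nil_end (v : vertex Q) r1 :
    is_path (inl v : vertex (aus_quiver I)) r1 -> underlying r1 = [::] ->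
    path_end (inl v : vertex (aus_quiver I)) r1 = inl v.
  by case: r1 => [//|[a|[a|a]] r1].
elim: r p r' => [|h r IHr] p [|h' r'] //=.
- case: h' => [a|[a|a]] //= _ /andP[/eqP<- rP] pE /esym uE.
  by have : inr a = inl _ :> (vertex Q + cyc_arrow I)%type := etrans pE (nil_end _ _ rP uE).
- case: h => [a|[a|a]] //= /andP[/eqP<- rP] _ pE uE.
  by have : inr a = inl _ :> (vertex Q + cyc_arrow I)%type := etrans (esym pE) (nil_end _ _ rP uE).
move=> /andP[/eqP<- rP] /andP[/eqP hh' rP'] pE.
have pE' : path_end (src h) r = path_end (src h') r' by [].
have end_rec : src h = src h' -> underlying r = underlying r' -> r = r'.
  move=> sh uE; have rP1 : is_path (src h) r' by rewrite sh.
  by apply: (IHr (src h)) => //; rewrite pE' sh.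
case: h h' hh' rP rP' pE pE' end_rec => [a|[a|a]] [a'|[a'|a']] //= [].
- move=> _ _ _ _ _ end_rec [/val_inj aE uE]; subst a'.
  by rewrite end_rec.
- move=> _ _ _ _ _ _ [aE _]; by have := valP a; rewrite /= aE (valP a').
- move=> -> _ _ _ _ end_rec uE; by rewrite end_rec.
- move=> _ _ _ _ _ _ [aE _]; by have := valP a'; rewrite /= -aE (valP a).
- move=> _ _ _ _ _ end_rec [/val_inj aE uE]; subst a'.
  by rewrite end_rec.
Qed.

Lemma realize_surj q v l : is_path v l -> final_arrow q v l ->
  exists r, [/\ is_path (inl v : vertex (aus_quiver I)) r,
    path_end (inl v : vertex (aus_quiver I)) r = q & underlying r = l].
Proof.
elim: l v => [|a l IHl] v /=.
  by case: q => // u _ /eqP <-; exists [::].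
case/andP=> /eqP <- lP fin.
have [ac|anc] := boolP (cyclic_arrow I a); last first.
  have [|r [rP rE rU]] := IHl _ lP.
    case: (q) fin => [//|c] /=; case: (l) => //= /eqP aE.
    by rewrite aE (valP c) in anc.
  exists ((inl (exist _ a anc) : aus_arrow I) :: r); split=> //=; last by rewrite rU.
  by rewrite eqxx.
(* If the path is to end at the vertex [a] itself, it stops after [a^-]; otherwise both [a^-] and
   [a^+] are inserted. *)
have [[c qE cE]|fin'] : (exists2 c, q = inr c & l = [::] /\ a = val c) \/ final_arrow q (src a) l.
  case: (q) fin => [u|c] /=; first by right.
  by case: (l) => [|b l1] /= fin; [left; exists c => //; split=> //; exact/eqP|right].
  case: cE => -> aE; exists [:: (inr (inr c) : aus_arrow I)]; split=> /=.
  - by rewrite aE eqxx.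
  - by rewrite qE.
  - by rewrite aE.
have [r [rP rE rU]] := IHl _ lP fin'.
exists ((inr (inr (exist _ a ac)) : aus_arrow I) :: inr (inl (exist _ a ac)) :: r).
by split; [rewrite /= !eqxx|exact: rE|rewrite /= rU].
Qed.

Lemma realize_ex p q l : is_path (gtgt (aus_type p)) l ->
  (if p is inr a then exists l', l = val a :: l' else True) ->
  final_arrow q (gtgt (aus_type p)) l ->
  exists r, [/\ is_path p r, path_end p r = q & realize p r = l].
Proof.
case: p => [v|a] /= lP; first by move=> _; exact: realize_surj.
case=> l' lE; move: lP; rewrite lE /= => /andP[_ lP] fin.
have [[c qE [l0 aE]]|fin'] :
    (exists2 c, q = inr c & l' = [::] /\ a = c) \/ final_arrow q (src (val a)) l'.
  case: (q) fin => [u|c] /=; first by right.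
  by case: (l') => [|b l1] /= fin; [left; exists c => //; split=> //; exact/val_inj/eqP|right].
  by exists [::]; split=> //; rewrite ?qE ?aE // l0.
have [r [rP rE rU]] := realize_surj lP fin'.
exists ((inr (inl a) : aus_arrow I) :: r); split=> //=; last by rewrite /realize /= rU.
by rewrite eqxx.
Qed.

(** * The opposite endomorphism algebra of a biproduct of the left ideals *)

Section Biproduct.
Variables (D : lmodType A) (inx : forall p, {linear gmod (aus_type p) -> D})
  (prx : forall p, {linear D -> gmod (aus_type p)}).
Hypothesis prinx : forall p u, prx p (inx p u) = u.
Hypothesis prinx0 : forall p q u, p != q -> prx q (inx p u) = 0.
Hypothesis sum_inx : forall z, \sum_p inx p (prx p z) = z.

Definition endo_op : kalgType K := (endo D)^c.
Definition act (b : endo_op) : {linear D -> D} := endo_fun b.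

Lemma act_inj (b c : endo_op) : (forall z, act b z = act c z) -> b = c.
Proof. exact: endo_eqP. Qed.
Lemma actM (b c : endo_op) z : act (b * c) z = act c (act b z). Proof. by []. Qed.
Lemma act0 z : act 0 z = 0. Proof. by []. Qed.
Lemma act1 z : act 1 z = z. Proof. by []. Qed.
Lemma actD (b c : endo_op) z : act (b + c) z = act b z + act c z. Proof. by []. Qed.
Lemma act_sum (J : Type) (l : seq J) (P : pred J) (f : J -> endo_op) z :
  act (\sum_(j <- l | P j) f j) z = \sum_(j <- l | P j) act (f j) z.
Proof. exact: (big_morph (act^~ z)). Qed.
Lemma actZ k (b : endo_op) z : act (kalg_in k * b) z = (kalg_in k : A) *: act b z.
Proof. by rewrite actM -[RHS]linearZ. Qed.

(* Maps between the left ideals are right multiplications. *)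
Definition step_elt h : A :=
  match h with inl a => arr (val a) | inr (inl _) => 1 | inr (inr a) => arr (val a) end.

Lemma step_princ h :
  princ (gen (aus_type (src h))) (gen (aus_type (tgt h)) * step_elt h).
Proof.
case: h => [a|[a|a]] /=.
- by exists (arr (val a)); rewrite idem_arr arr_idem !eqxx.
- by exists (arr (val a)); apply: (etrans (mulr1 _)); rewrite arr_idem eqxx.
by exists 1; rewrite idem_arr eqxx mul1r.
Qed.

(** The arrow [a^+] acts as the inclusion of [A a] in [A e_(src a)], and [a^-] as the surjection of
    [A e_(tgt a)] onto [A a]. Maps go from target to source because products are taken in the
    opposite ring. *)
Definition step h : {linear gmod (aus_type (tgt h)) -> gmod (aus_type (src h))} :=
  proj1_sig (cid (gmod_rmul (step_princ h))).

Lemma stepE h u : fval _ (step h u) = fval _ u * step_elt h.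
Proof. by rewrite /step; case: cid => f /= ->. Qed.

Definition vertex_endo p : endo_op := (inx p \o prx p : {linear D -> D}).
Definition arrow_endo h : endo_op := (inx (src h) \o (step h \o prx (tgt h)) : {linear D -> D}).

Lemma vertex_endoE p z : act (vertex_endo p) z = inx p (prx p z). Proof. by []. Qed.
Lemma arrow_endoE h z : act (arrow_endo h) z = inx (src h) (step h (prx (tgt h) z)).
Proof. by []. Qed.

Lemma vertex_endoM p q : vertex_endo p * vertex_endo q = if p == q then vertex_endo p else 0.
Proof.
apply: act_inj => z; rewrite actM !vertex_endoE; case: eqVneq => [<-|pq].
  by rewrite prinx.
by rewrite prinx0 // linear0.
Qed.

Lemma sum_vertex_endo : \sum_p vertex_endo p = 1.
Proof. by apply: act_inj => z; rewrite act_sum act1 sum_inx. Qed.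

Lemma vertex_arrow_endo h : vertex_endo (tgt h) * arrow_endo h = arrow_endo h.
Proof. by apply: act_inj => z; rewrite actM vertex_endoE !arrow_endoE prinx. Qed.

Lemma arrow_vertex_endo h : arrow_endo h * vertex_endo (src h) = arrow_endo h.
Proof. by apply: act_inj => z; rewrite actM vertex_endoE arrow_endoE prinx. Qed.

Notation pval := (path_val vertex_endo arrow_endo).

Lemma act_path p r z : is_path p r -> exists2 w : gmod (aus_type (path_end p r)),
  act (pval p r) z = inx (path_end p r) w
  & fval _ w = fval _ (prx p z) * \prod_(h <- r) step_elt h.
Proof.
elim: r p z => [|h r IHr] p z.
  move=> _; exists (prx p z); last by rewrite big_nil mulr1.
  by rewrite /path_val big_nil mulr1.
case/andP=> /eqP<- rP; rewrite (path_val_cons vertex_arrow_endo arrow_vertex_endo) actM.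
have [w wE wv] := IHr _ (act (arrow_endo h) z) rP.
by exists w => //; rewrite wv big_cons mulrA arrow_endoE prinx stepE.
Qed.

Lemma gen_prod p r : is_path p r ->
  gen (aus_type p) * \prod_(h <- r) step_elt h = path_cls (gtgt (aus_type p)) (realize p r).
Proof.
elim: r p => [|h r IHr] p.
  by move=> _; rewrite big_nil mulr1 gen_cls /realize cats0.
case/andP=> /eqP<- /IHr {IHr}; rewrite big_cons mulrA.
case: h => [a|[a|a]] rE.
- change (idem (tgt (val a)) * arr (val a) * \prod_(h <- r) step_elt h =
    path_cls (tgt (val a)) (val a :: underlying r)).
  by rewrite idem_arr eqxx path_cls_cons -[path_cls _ _]rE mulrA arr_idem eqxx.
- change (arr (val a) * 1 * \prod_(h <- r) step_elt h =
    path_cls (tgt (val a)) (val a :: underlying r)).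
  by rewrite mulr1 path_cls_cons -[path_cls _ _]rE mulrA arr_idem eqxx.
change (idem (tgt (val a)) * arr (val a) * \prod_(h <- r) step_elt h =
  path_cls (tgt (val a)) (val a :: underlying r)).
by rewrite idem_arr eqxx; exact: rE.
Qed.

Lemma path_val_free0 p r : is_path p r -> ~~ relation_free I (realize p r) -> pval p r = 0.
Proof.
move=> pr nfree; apply: act_inj => z; have [w -> wE] := act_path z pr.
rewrite (_ : w = 0) ?linear0 //; apply: fval_inj; rewrite wE linear0.
have [c ->] := gmod_elt (prx p z).
rewrite fvalZ fval_gen -mulrA gen_prod // path_cls0 ?mulr0 //.
by rewrite /nonzero_path negb_and nfree orbT.
Qed.

Definition endo_lift : {rmorphism path_alg K (aus_quiver I) -> endo_op} :=
  path_lift_morph vertex_endoM sum_vertex_endo vertex_arrow_endo arrow_vertex_endo.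

Lemma endo_liftZ k (x : path_alg K (aus_quiver I)) :
  endo_lift (kalg_in k * x) = kalg_in k * endo_lift x.
Proof. exact: path_liftZ. Qed.

Lemma endo_lift_raw p r : is_path p r -> endo_lift (raw_elt K p r) = pval p r.
Proof. exact: path_lift_raw. Qed.

Lemma endo_lift_relation (x : path_alg K (aus_quiver I)) :
  relation_ideal K (aus_rel I) x -> endo_lift x = 0.
Proof.
have k0 : endo_lift 0 = 0 by exact: raddf0.
have kD (y z : path_alg K (aus_quiver I)) :
    endo_lift y = 0 -> endo_lift z = 0 -> endo_lift (y + z) = 0.
  by rewrite rmorphD => -> ->; rewrite addr0.
have kMl (c y : path_alg K (aus_quiver I)) : endo_lift y = 0 -> endo_lift (c * y) = 0.
  by rewrite rmorphM => ->; rewrite mulr0.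
have kMr (y c : path_alg K (aus_quiver I)) : endo_lift y = 0 -> endo_lift (y * c) = 0.
  by rewrite rmorphM => ->; rewrite mul0r.
move=> xI; apply: (xI (Ideal k0 kD kMl kMr)) => _ [h' [h [rel ->]]] /=.
have hh' := aus_rel_comp rel.
have hP : is_path (tgt h') [:: h'; h] by apply/and3P; split=> //; exact/eqP.
rewrite !arrow_eltE raw_eltM hh' eqxx.
change (endo_lift (raw_elt K (tgt h') [:: h'; h]) = 0); rewrite endo_lift_raw //.
apply: path_val_free0 => //.
by case: h' h rel {hh' hP} => [b|[b|b]] [a|[a|a]] //= Iba; rewrite /realize /= Iba.
Qed.

(** The image of the generator of the p-th summand is a combination of paths of [Q]; by
    [underlying_inj], different Auslander paths from [p] to the same end contribute different ones.
    Every coefficient can thus be read off, which yields the kernel. *)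
Lemma endo_lift_coef p r : nonzero_path (aus_rel I) p r -> forall x : path_alg K (aus_quiver I),
  cls_coef (gtgt (aus_type p)) (realize p r)
     (fval _ (prx (path_end p r) (act (endo_lift x) (inx p (fgen (aus_type p))))))
  = path_coef p r x.
Proof.
move=> pr; have /andP[prP prF] := pr.
have nz : nonzero_path I (gtgt (aus_type p)) (realize p r).
  by rewrite /nonzero_path realize_path //= realize_free.
elim/path_alg_ind => [|x y IHx IHy|k x IH|q r' qr'].
- rewrite raddf0 act0 linear0 linear0 cls_coef0 /path_coef.
  by case: insub => // u; rewrite mcoeff0.
- by rewrite rmorphD actD !linearD cls_coefD IHx IHy path_coefD.
- by rewrite endo_liftZ actZ linearZ fvalZ cls_coefZ IH path_coefZ.
rewrite endo_lift_raw // path_coef_raw prP.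
have [w -> wE] := act_path (inx p (fgen (aus_type p))) qr'.
case: (eqVneq p q) => [pq|pq]; last first.
  rewrite (_ : w = 0) ?linear0 ?linear0 ?cls_coef0 ?xpair_eqE ?(negPf pq) //.
  by apply: fval_inj; rewrite wE prinx0 // !linear0 mul0r.
subst q; rewrite prinx fval_gen gen_prod // in wE.
case: (eqVneq (path_end p r) (path_end p r')) => [rr'|rr']; last first.
  rewrite prinx0 1?eq_sym // linear0 cls_coef0; case: ((p, r') =P (p, r)) => [[E]|_];
    last by rewrite mul0rn.
  by rewrite E eqxx in rr'.
rewrite rr' prinx wE cls_coef_cls nz !xpair_eqE !eqxx.
case: (eqVneq r r') => [->|ne]; first by rewrite !eqxx.
case: (realize p r =P realize p r') => [|//];
  rewrite /realize => /(congr1 (drop (size (glist (aus_type p))))).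
rewrite !drop_size_cat // => uE.
by rewrite (underlying_inj prP qr' rr' uE) eqxx in ne.
Qed.

Lemma endo_lift_ker (x : path_alg K (aus_quiver I)) :
  endo_lift x = 0 <-> relation_ideal K (aus_rel I) x.
Proof.
split=> [x0|]; last exact: endo_lift_relation.
apply/(relation_idealP aus_rel_comp) => p r pr.
by rewrite -(endo_lift_coef pr) x0 act0 !linear0 cls_coef0.
Qed.

(** Validity fixes the beginning of the paths occurring in [u], as [b u = 0] with [I b a] forces the
    first arrow to be [a]; membership in the left ideal [gmod (aus_type q)] fixes their end. Then
    [realize_ex] applies. *)
Lemma valid_support p q (u : gmod (aus_type q)) v l : valid (aus_type p) u ->
  nonzero_path I v l -> cls_coef v l (fval _ u) != 0 ->
  exists r, [/\ is_path p r, path_end p r = q, gtgt (aus_type p) = v & realize p r = l].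
Proof.
move=> [pu up] vl u0.
have uE : idem (gtgt (aus_type p)) * fval _ u = fval _ u by rewrite -fvalZ pu.
have vE : gtgt (aus_type p) = v.
  by move: u0; rewrite -uE cls_coef_idemM; case: (v =P _) => // _; rewrite eqxx.
have [|||r [rP rE rl]] := @realize_ex p q l.
- by rewrite vE; case/andP: vl.
- case: p pu up uE vE => // a pu up uE vE.
  have [[b Iba _] _] := cyclic_arrow_nbrs (valP a).
  have : arr b * fval _ u = 0 by rewrite -fvalZ (up b Iba) linear0.
  move=> /arrM_eq0[d]; rewrite -(Icomp Iba) uE => wE.
  move: u0; rewrite wE cls_coef_sum (bigD1 (val a)) //= big1 ?addr0 => [|a' /andP[Iba']];
    last first.
    by rewrite (Iuniq_pred Iba' Iba) eqxx.
  rewrite cls_coef_arrM; case: (l) => [|a' l']; first by rewrite eqxx.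
  by case: (eqVneq a' (val a)) => [->|]; [exists l'|rewrite mulr0n eqxx].
- rewrite vE; have [c cE] := gmod_elt u.
  move: u0; rewrite cE fvalZ fval_gen; case: (q) => [w|a] /=.
    by rewrite cls_coef_Midem; case: (path_end v l =P w) => // _; rewrite eqxx.
  rewrite cls_coef_Marr; case: (l) => [|a' l']; first by rewrite eqxx.
  by case: (last a' l' =P val a) => // _; rewrite mulr0n eqxx.
by exists r.
Qed.

Lemma endo_lift_hom p q (f : {linear gmod (aus_type p) -> gmod (aus_type q)}) :
  exists x : path_alg K (aus_quiver I), forall z, act (endo_lift x) z = inx q (f (prx p z)).
Proof.
(* The map [g] is kept along with [x] because a linear map is determined by the image [w] of the
   generator, and [w] can be decomposed into paths. *)
pose P (w : A) := exists (x : path_alg K (aus_quiver I))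
    (g : {linear gmod (aus_type p) -> gmod (aus_type q)}),
  (forall z, act (endo_lift x) z = inx q (g (prx p z))) /\ fval _ (g (fgen (aus_type p))) = w.
suff [x [g [xE gf]]] : P (fval _ (f (fgen (aus_type p)))).
  by exists x => z; rewrite xE (gmod_hom_eq (fval_inj gf)).
apply: (bound_span (P := P)) => [|_ _ [x [g [xE <-]]] [y [g' [yE <-]]]|k _ [x [g [xE <-]]]|v l vl w0].
- by exists 0, \0; split=> [z|]; rewrite ?raddf0 ?linear0.
- exists (x + y), (g \+ g'); split=> [z|]; last by rewrite linearD.
  by rewrite rmorphD actD xE yE -linearD.
- exists (kalg_in k * x), (homothety k \o g); split=> [z|]; last by rewrite fvalZ.
  by rewrite endo_liftZ actZ xE -linearZ.
have [r [pr rq rv rl]] := valid_support (hom_valid f (fgen_valid _)) vl w0.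
subst q; exists (raw_elt K p r).
exists (prx (path_end p r) \o (act (pval p r) \o inx p)); split=> [z|].
  have [w wE _] := act_path (inx p (prx p z)) pr.
  change (act (endo_lift (raw_elt K p r)) z =
    inx (path_end p r) (prx (path_end p r) (act (pval p r) (inx p (prx p z))))).
  rewrite endo_lift_raw // wE prinx -wE.
  by rewrite -[pval p r in LHS](eps_path_val arrow_endo vertex_endoM) actM vertex_endoE.
have [w wE wv] := act_path (inx p (fgen (aus_type p))) pr.
change (fval _ (prx (path_end p r) (act (pval p r) (inx p (fgen (aus_type p))))) = path_cls v l).
by rewrite wE prinx wv prinx fval_gen gen_prod // rv rl.
Qed.

(** The matrix entries of [b] with respect to the biproduct are realized one by one and added up. *)
Lemma endo_lift_surj (b : endo_op) : exists x : path_alg K (aus_quiver I), endo_lift x = b.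
Proof.
have /boolp.choice[x xE] := fun pq : vertex (aus_quiver I) * vertex (aus_quiver I) =>
  endo_lift_hom (prx pq.2 \o (act b \o inx pq.1)).
exists (\sum_pq x pq); apply: act_inj => z; rewrite rmorph_sum act_sum.
rewrite -[in RHS](sum_inx z) linear_sum.
under [RHS]eq_bigr => p _ do rewrite -[act b _]sum_inx.
by rewrite pair_bigA; apply: eq_bigr => -[p q] _; rewrite xE.
Qed.

Lemma biproduct_endo_iso : kalg_iso endo_op (bound_quiver_alg K (aus_rel I)).
Proof.
apply: kalg_iso_sym.
apply: (quot_kalg_iso (f := endo_lift)); [|exact: endo_lift_ker|exact: endo_lift_surj].
exact: path_lift_morph_in.
Qed.

End Biproduct.

(** The given list agrees with the modules [gmod (aus_type p)] up to isomorphisms and a bijection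
    [s] of the indices, which makes [dsum E] a biproduct of the latter. *)
Lemma gentle_Aus_iso n (E : 'I_n -> lmodType A) : indec_Gproj_list E ->
  kalg_iso (Aus E) (bound_quiver_alg K (aus_rel I)).
Proof.
case=> EG Einj Eall.
have Fiso (p q : vertex (aus_quiver I)) : mod_iso (gmod (aus_type p)) (gmod (aus_type q)) -> p = q.
  by move=> /(gmod_iso_inj (aus_type_succ p) (aus_type_succ q))/aus_type_inj.
have /boolp.choice[s sP] : forall p, exists i, mod_iso (gmod (aus_type p)) (E i).
  by move=> p; apply: Eall; [exact: aus_type_Gproj|exact: gmod_indecomposable].
have s_inj : injective s.
  by move=> p q spq; apply: Fiso; apply: mod_iso_trans (sP p) _; rewrite spq; exact: mod_iso_sym.
have s_surj i : exists p, s p = i.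
  have [EGi Ei] := EG i; have [p pE] := indecomposable_Gproj EGi Ei.
  by exists p; apply/esym/Einj; apply: mod_iso_trans pE (sP p).
have iso p : exists fg :
    {linear gmod (aus_type p) -> E (s p)} * {linear E (s p) -> gmod (aus_type p)},
    cancel fg.1 fg.2 /\ cancel fg.2 fg.1.
  by have /mod_isoP[f [g fg]] := sP p; exists (f, g).
pose fg p := proj1_sig (cid (iso p)).
have [fgK gfK] : (forall p, cancel (fg p).1 (fg p).2) /\ (forall p, cancel (fg p).2 (fg p).1).
  by split=> p; rewrite /fg; case: cid => ? [].
pose inx p : {linear gmod (aus_type p) -> dsum E} :=
  lin_of (@dsum_inj_linear A n E (s p)) \o (fg p).1.
pose prx p : {linear dsum E -> gmod (aus_type p)} := (fg p).2 \o dsum_proj E (s p).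
have inxE p u : inx p u = dsum_inj ((fg p).1 u) by [].
have prxE p z : prx p z = (fg p).2 (z (s p)) by [].
apply: (@biproduct_endo_iso _ inx prx) => [p u|p q u pq|z].
- by rewrite prxE inxE dsum_inj_in fgK.
- by rewrite prxE inxE dsum_inj_out ?linear0 // (inj_eq s_inj).
apply: functional_extensionality_dep => i; have [p <-] := s_surj i.
rewrite -[LHS]/(dsum_proj E (s p) _) linear_sum (bigD1 p) //= big1 => [|q qp].
  by rewrite addr0 -[LHS]/(inx p (prx p z) (s p)) inxE prxE gfK dsum_inj_in.
by rewrite -[LHS]/(inx q (prx q z) (s p)) inxE dsum_inj_out // (inj_eq s_inj).
Qed.

End GentleAlgebra.

Theorem theorem3p5 (K : closedFieldType) (Q : quiver) (I : rel (arrow Q)) :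
  gentle K I ->
  CM_finite (bound_quiver_alg K I) /\
  forall (n : nat) (E : 'I_n -> lmodType (bound_quiver_alg K I)),
    indec_Gproj_list E ->
    kalg_iso (Aus E) (bound_quiver_alg K (aus_rel I)).
Proof.
case=> Icomp Iadm _ _ Iuniq.
have Isucc a b b' : I b a -> I b' a -> b = b'.
  move=> Iba Ib'a; apply: (proj2 (Iuniq a b b')) => //; exact/esym/Icomp.
have Ipred b a a' : I b a -> I b a' -> a = a'.
  by move=> Iba Iba'; apply: (proj1 (Iuniq b a a')) => //; exact: Icomp.
by split=> [|n E]; [exact: gentle_CM_finite|exact: gentle_Aus_iso].
Qed.
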